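(* Consider the finite-template model (mean-shift or variance-shift, described in the context) in the smooth-signal regime, and let $\mathcal{E}=\max_{\ell\in[m]}\sum_{u\in[k]\times[k]}\vartheta_{\ell,u}^2$, where $\vartheta_\ell=M_\ell$ in the mean-shift model and $\vartheta_\ell=\Sigma_\ell$ in the variance-shift model. 1. Under the non-consecutive placement family $\mathcal{K}_{k,m,n}$, if $$\mathcal{E}=o\left(k\wedge\frac{n^2}{m^2k^2}\right),$$ then $d_{\mathsf{TV}}(\mathbb{P}_{\mathcal{H}_0},\mathbb{P}_{\mathcal{H}_1})=o(1)$. 2. Under the circular consecutive placement family $\mathcal{K}^{\circ}_{k,m,n}$, if $$\mathcal{E}=o\left(\log\left(1+\frac{n^2}{k^2m^2}\right)\right),$$ then $d_{\mathsf{TV}}(\mathbb{P}_{\mathcal{H}_0},\mathbb{P}_{\mathcal{H}_1})=o(1)$.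
   Context: **Asymptotics.** All asymptotic statements are as $n\to\infty$; $m=m(n)$, $k=k(n)$ are positive integers with $mk\le n$, and the templates may depend on $n$. $[k]=\{1,\dots,k\}$; $a\wedge b=\min\{a,b\}$; $\|M\|_\infty=\max_{i,j}|M_{ij}|$; $d_{\mathsf{TV}}(\mathbb{P},\mathbb{Q})=\frac12\int|\mathrm{d}\mathbb{P}-\mathrm{d}\mathbb{Q}|$. **Blocks and placements.** $\mathcal{B}_{k,n}=\{S\times T: S,T\subset[n],\ |S|=|T|=k\}$. $\mathcal{B}^{\circ}_{k,n}$ is the set of $S\times T$ with $S,T\in\{\{i+1,\dots,i+k\}\bmod n: i=0,\dots,n-1\}$, indices taken modulo $n$ with representatives in $[n]$. The non-consecutive placement family $\mathcal{K}_{k,m,n}$ and the circular consecutive placement family $\mathcal{K}^{\circ}_{k,m,n}$ are the sets of all unordered collections of $m$ pairwise disjoint blocks from $\mathcal{B}_{k,n}$ and $\mathcal{B}^{\circ}_{k,n}$, respectively. For a block $B=S\times T$ with $S=\{s_1<\dots<s_k\}$, $T=\{t_1<\dots<t_k\}$, the coordinate map $\varphi_B:B\to[k]\times[k]$ is $\varphi_B(s_u,t_v)=(u,v)$. **Models.** One observes $X\in\mathbb{R}^{n\times n}$. Under $\mathcal{H}_0$ the entries are i.i.d. $\mathcal{N}(0,1)$ (law $\mathbb{P}_{\mathcal{H}_0}$). Under $\mathcal{H}_1$, $K$ is drawn uniformly from the specified placement family, then, conditional on $K$, a bijection $\beta:K\to[m]$ is drawn uniformly; given $(K,\beta)$ the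 entries of $X$ are independent with $X_{ij}\sim\mathcal{P}_{\beta(B),\varphi_B(i,j)}$ if $(i,j)\in B$ for some $B\in K$, and $X_{ij}\sim\mathcal{N}(0,1)$ otherwise. $\mathbb{P}_{\mathcal{H}_1}$ is the marginal (mixture) law of $X$. Mean-shift model: $\mathcal{P}_{\ell,u}=\mathcal{N}((M_\ell)_u,1)$ with $M_\ell\in\mathbb{R}^{k\times k}$, $\ell\in[m]$. Variance-shift model: $\mathcal{P}_{\ell,u}=\mathcal{N}(0,1+(\Sigma_\ell)_u)$ with $0\le(\Sigma_\ell)_u\le\vartheta_0$ for a fixed $\vartheta_0\in[0,1)$ independent of $n$. **Smooth-signal regime.** With $\mathcal{E}_\ell=\sum_{u\in[k]\times[k]}\vartheta_{\ell,u}^2$, the model operates in the smooth-signal regime if $\sup_{\ell\in[m]}\|\vartheta_\ell\|_\infty=O(1)$ (uniform boundedness) and $\sup_{\ell\in[m]}\frac{k^2\|\vartheta_\ell\|_\infty^2}{\mathcal{E}_\ell}=O(1)$ (non-spikiness). *)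

(* Defs.v *)
From HB Require Import structures.
From mathcomp Require Import all_boot all_order all_algebra.
From mathcomp Require Import all_classical all_reals all_analysis.

Set Implicit Arguments.
Unset Strict Implicit.
Unset Printing Implicit Defensive.

Import Order.TTheory GRing.Theory Num.Theory.
Import numFieldNormedType.Exports.

Local Open Scope classical_set_scope.
Local Open Scope ring_scope.

Definition entry_cylinders (R : realType) (n : nat) : set (set 'M[R]_n) :=
  [set C | exists (c : 'I_n * 'I_n) (A : set (measurableTypeR R)),
      measurable A /\ C = [set X : 'M[R]_n | A (X c.1 c.2)]].

(* R^(n x n) with its Borel sigma-algebra, presented as the sigma-algebra
   generated by the entries. *)
Definition observation (R : realType) (n : nat) :
    measurableType (sigma_display (@entry_cylinders R n)) :=
  g_sigma_algebraType (@entry_cylinders R n).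

Section independent_entries.
Context {R : realType}.
Local Notation RR := (measurableTypeR R).

Definition pair_to_tuple (N : nat) (x : RR * N.-tuple RR) : N.+1.-tuple RR :=
  [the N.+1.-tuple RR of x.1 :: x.2].

Lemma measurable_pair_to_tuple N : measurable_fun [set: _] (@pair_to_tuple N).
Proof. exact: measurable_cons. Qed.

HB.instance Definition _ N := isMeasurableFun.Build _ _ _ _
  (@pair_to_tuple N) (@measurable_pair_to_tuple N).

(* The product of the laws mu 0, ..., mu (N - 1) on N-tuples. *)
Fixpoint tuple_law (N : nat) : ('I_N -> probability RR R) ->
    probability (N.-tuple RR) R :=
  if N is N'.+1 then fun mu =>
    distribution (mu ord0 \x tuple_law (fun i => mu (lift ord0 i)))%E
      (@pair_to_tuple N')
  else fun=> \d_([tuple] : 0.-tuple RR).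

Definition tuple_to_matrix (n : nat) (t : #|{: 'I_n * 'I_n}|.-tuple RR) :
  observation R n := \matrix_(i, j) tnth t (enum_rank (i, j)).

Lemma measurable_tuple_to_matrix n :
  measurable_fun [set: _] (@tuple_to_matrix n).
Proof.
apply: (@measurability _ _ _ (observation R n) _ _ (@entry_cylinders R n)) => //.
move=> _ [_ [c [A [mA ->]]] <-]; rewrite setTI.
have -> : @tuple_to_matrix n @^-1` [set X : 'M[R]_n | A (X c.1 c.2)] =
    (fun t => tnth t (enum_rank c)) @^-1` A.
  by apply/seteqP; split=> t /=; rewrite /tuple_to_matrix mxE -surjective_pairing.
rewrite -[X in measurable X]setTI.
by apply: measurable_tnth.
Qed.

HB.instance Definition _ n := isMeasurableFun.Build _ _ _ _
  (@tuple_to_matrix n) (@measurable_tuple_to_matrix n).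

(* The law of a random matrix with independent entries X_ij ~ mu (i, j). *)
Definition independent_law (n : nat) (mu : 'I_n * 'I_n -> probability RR R) :
    probability (observation R n) R :=
  distribution (tuple_law (fun l => mu (enum_val l))) (@tuple_to_matrix n).

Lemma tuple_law_box N (mu : 'I_N -> probability RR R) (A : 'I_N -> set RR) :
  (forall i, measurable (A i)) ->
  tuple_law mu [set t | forall i, A i (tnth t i)] =
  (\prod_(i < N) mu i (A i))%E.
Proof.
elim: N mu A => [|N IH] mu A mA.
  rewrite big_ord0 /= diracE mem_set//= => -[]//.
rewrite big_ord_recl /= /distribution/= /pushforward/=.
have mB : measurable [set t : N.-tuple RR | forall i, A (lift ord0 i) (tnth t i)].
  have -> : [set t : N.-tuple RR | forall i, A (lift ord0 i) (tnth t i)] =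
      \bigcap_(i in [set: 'I_N]) ((fun t => tnth t i) @^-1` A (lift ord0 i)).
    by apply/seteqP; split=> t /= H i; [move=> _; exact: H|exact: (H i)].
  apply: fin_bigcap_measurable => [|i _]; first exact: finite_finset.
  by rewrite -[X in measurable X]setTI; apply: measurable_tnth.
rewrite -IH => [|i]; last exact: mA.
rewrite -product_measure1E//; congr (_ _); apply/seteqP; split=> -[x t] /=.
  move=> H; split; first by have := H ord0.
  by move=> i; have := H (lift ord0 i); rewrite tnthS.
move=> [Ax At] i; case: (unliftP ord0 i) => [j ->|->//].
by rewrite tnthS; exact: At.
Qed.

Lemma independent_law_box n (mu : 'I_n * 'I_n -> probability RR R)
    (A : 'I_n * 'I_n -> set RR) : (forall c, measurable (A c)) ->
  independent_law mu [set X : 'M[R]_n | forall c, A c (X c.1 c.2)] =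
  (\prod_c mu c (A c))%E.
Proof.
move=> mA.
rewrite (reindex _ (onW_bij _ (@enum_val_bij ('I_n * 'I_n)%type))).
have <- := tuple_law_box (fun l => mu (enum_val l)) (fun l => mA (enum_val l)).
rewrite /independent_law /distribution /pushforward.
suff E : @tuple_to_matrix n @^-1` [set X : 'M[R]_n | forall c, A c (X c.1 c.2)] =
    [set t | forall l, A (enum_val l) (tnth t l)].
  exact: (congr1 (tuple_law (fun l => mu (enum_val l))) E).
apply/seteqP; split=> t /= H => [l|c].
  have := H (enum_val l).
  by rewrite /tuple_to_matrix mxE -surjective_pairing enum_valK.
have := H (enum_rank c).
by rewrite /tuple_to_matrix mxE -surjective_pairing enum_rankK.
Qed.

End independent_entries.

Section uniform_mixture.
Local Open Scope ereal_scope.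
Context d (T : measurableType d) (R : realType).
Variables (J : finType) (A : {set J}).
Variable P : J -> {finite_measure set T -> \bar R}.

(* The law obtained by drawing j uniformly from A, then a point from P j; it is
   the zero measure when A is empty. *)
Definition uniform_mixture (E : set T) : \bar R :=
  (#|A|%:R^-1 : R)%:E * \sum_(j in A) P j E.

Let mixture0 : uniform_mixture set0 = 0.
Proof. by rewrite /uniform_mixture big1 ?mule0. Qed.

Let mixture_ge0 E : 0 <= uniform_mixture E.
Proof. by rewrite mule_ge0 ?sume_ge0 ?lee_fin ?invr_ge0. Qed.

Let mixture_sigma_additive : semi_sigma_additive uniform_mixture.
Proof.
move=> F mF tF mUF; rewrite /uniform_mixture.
rewrite [X in X @ \oo --> _](_ : _ = (fun k =>
    (#|A|%:R^-1 : R)%:E * \sum_(j in A) \sum_(0 <= i < k) P j (F i))); last first.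
  apply/funext => k; rewrite exchange_big/= ge0_sume_distrr// => i _.
  exact: sume_ge0.
apply: cvgeZl => //.
by apply: cvg_nnesum => [j _|j _]; [apply: nearW => k; exact: sume_ge0|
  exact: measure_semi_sigma_additive].
Qed.

HB.instance Definition _ := isMeasure.Build _ _ _ uniform_mixture
  mixture0 mixture_ge0 mixture_sigma_additive.

Let mixture_fin : fin_num_fun uniform_mixture.
Proof.
move=> E mE; rewrite fin_numM// sum_fin_num.
by apply/allP => x /mapP[j _ ->]; exact: fin_num_measure.
Qed.

HB.instance Definition _ := Measure_isFinite.Build _ _ _
  uniform_mixture mixture_fin.

Lemma uniform_mixture_setT : (0 < #|A|)%N ->
  (forall j, j \in A -> P j setT = 1) -> uniform_mixture setT = 1.
Proof.
move=> A0 P1; rewrite /uniform_mixture (eq_bigr (fun=> 1%:E))//.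
rewrite sumEFin -EFinM sumr_const mulVf// pnatr_eq0 -lt0n//.
Qed.

End uniform_mixture.

Section total_variation_distance.
Local Open Scope ereal_scope.
Context d (T : measurableType d) (R : realType).
Variables P Q : {finite_measure set T -> \bar R}.

Definition difference_charge : {charge set T -> \bar R} :=
  cadd (charge_of_finite_measure P) (copp (charge_of_finite_measure Q)).

(* Half the total mass of the variation measure |P - Q|. The variation does not
   depend on the Hahn decomposition used to express it. *)
Definition dTV : \bar R :=
  let hahn := cid (Hahn_decomposition difference_charge) in
  2^-1%:E * charge_variation (svalP (cid (svalP hahn))) setT.

End total_variation_distance.

Section placements.
Local Open Scope set_scope.
Local Open Scope nat_scope.
Variable n : nat.
Implicit Types (k m : nat).

(* The block S x T is encoded by the pair (S, T), which it determines as soon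
   as S and T are nonempty; indices run from 0 to n - 1. *)
Definition block := ({set 'I_n} * {set 'I_n})%type.

Definition cells (B : block) : {set 'I_n * 'I_n} := finset.setX B.1 B.2.

Definition blocks k : {set block} :=
  [set B : block | (#|B.1| == k) && (#|B.2| == k)]%SET.

Definition circular_interval k (a : 'I_n) : {set 'I_n} :=
  [set x : 'I_n | [exists d : 'I_k, val x == (a + d) %% n]]%SET.

Definition circular_blocks k : {set block} :=
  [set B : block | [exists a, B.1 == circular_interval k a] &&
                   [exists b, B.2 == circular_interval k b]]%SET.

Definition placements (Bs : {set block}) m : {set {set block}} :=
  [set K : {set block} | [&& K \subset Bs, #|K| == m &
    [forall B in K, forall B' in K,
      (B != B') ==> [disjoint cells B & cells B']]]]%SET.

(* The bijections from K to 'I_m. *)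
Definition labelings (K : {set block}) m : {set {ffun {B | B \in K} -> 'I_m}} :=
  [set b : {ffun {B | B \in K} -> 'I_m} |
    injectiveb b && [forall l, exists B, b B == l]]%SET.

(* enum lists a subset of 'I_n in increasing order, and index returns the size
   of the list for an element not in it. So, for B = (S, T) with
   #|S| = #|T| = k, this is Some (u, v) at the cell (s_u, t_v), and None
   outside B. *)
Definition coordinate_map k (B : block) (c : 'I_n * 'I_n) :
    option ('I_k * 'I_k) :=
  if (insub (index c.1 (enum B.1)), insub (index c.2 (enum B.2)))
    is (Some u, Some v) then Some (u, v) else None.

End placements.

Inductive shift_model := MeanShift | VarianceShift.

Section models.
Variable R : realType.
Local Notation RR := (measurableTypeR R).

(* The second parameter of normal_prob is the standard deviation. *)
Definition entry_law (sh : shift_model) (x : R) : probability RR R :=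
  match sh with
  | MeanShift => normal_prob x 1
  | VarianceShift => normal_prob 0 (Num.sqrt (1 + x))
  end.

Definition null_law n : probability (observation R n) R :=
  independent_law (fun=> normal_prob 0 1 : probability RR R).

Definition planted_entry_law sh n m k (theta : 'I_m -> 'M[R]_k)
    (K : {set block n}) (b : {ffun {B | B \in K} -> 'I_m})
    (c : 'I_n * 'I_n) : probability RR R :=
  if [pick B : {B | B \in K} | c \in cells (val B)] is Some B then
    if coordinate_map k (val B) c is Some u
    then entry_law sh (theta (b B) u.1 u.2)
    else normal_prob 0 1
  else normal_prob 0 1.

(* K is uniform over the placements of m blocks taken from Bs and, given K,
   beta is uniform over the bijections from K to 'I_m. *)
Definition alternative_law sh n m k (Bs : {set block n})
    (theta : 'I_m -> 'M[R]_k) : {finite_measure set (observation R n) -> \bar R} :=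
  uniform_mixture (placements Bs m) (fun K =>
    uniform_mixture (labelings K m) (fun b =>
      independent_law (planted_entry_law sh theta b))).

Definition energy k (M : 'M[R]_k) : R :=
  \sum_(u : 'I_k * 'I_k) M u.1 u.2 ^+ 2.

Definition max_energy m k (theta : 'I_m -> 'M[R]_k) : R :=
  \big[Num.max/0]_(l < m) energy (theta l).

Definition admissible_templates (sh : shift_model) (m k : nat -> nat)
    (theta : forall n, 'I_(m n) -> 'M[R]_(k n)) : Prop :=
  match sh with
  | MeanShift => True
  | VarianceShift => exists2 theta0 : R, 0 <= theta0 < 1 &
      forall n, (0 < n)%N ->
        forall l u v, 0 <= theta n l u v <= theta0
  end.

(* `|M| is the entrywise sup norm mx_norm. A zero template contributes
   0 / 0 = 0 to the non-spikiness ratio, so zero templates are allowed. *)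
Definition smooth_signal (m k : nat -> nat)
    (theta : forall n, 'I_(m n) -> 'M[R]_(k n)) : Prop :=
  ((fun n => \big[Num.max/0]_(l < m n) `|theta n l|) =O_\oo (fun=> 1 : R)) /\
  ((fun n => \big[Num.max/0]_(l < m n)
     ((k n)%:R ^+ 2 * `|theta n l| ^+ 2 / energy (theta n l)))
   =O_\oo (fun=> 1 : R)).

End models.

(* Main.v *)
(* The total variation distance is controlled by the second moment of the
   likelihood ratio, which is the average, over two independent placements K and
   K', of a product over the cells. Cells outside the intersection of the supports
   of K and K' contribute 1, and by non-spikiness every common cell contributes at
   most exp(lam) with lam = O(E / k^2). It therefore suffices that, for every fixed
   K, the average of exp(lam Y) over K' tends to 1, Y being the number of common
   cells. The labelings play no role in this bound.

   Circular blocks: when 8 k <= n, a block of K' drawn given all the others hits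
   the support of K with probability O(m k^2 / n^2), so resampling the blocks one
   at a time bounds the average as if they were independent. When 8 k > n there
   are fewer than 8 blocks.

   Non-consecutive blocks: it suffices to bound lam E[Y exp(lam Y)] by a small
   multiple of E[exp(lam Y)]. A common cell (i, j) in a block of K' is moved to a
   uniform place (i', j') by exchanging i with i' and j with j' in that block, which
   changes Y by at most 4 k. The exchange may break disjointness, but disjoint blocks
   do not share both rows and columns, so each block has half of the rows or half of
   the columns at its disposal. The blocks movable in one direction only share lines
   with unusually many others, and moving them in their free direction shows that
   they contribute little. *)
Require Import Defs.
From mathcomp Require Import all_boot all_order all_algebra all_fingroup.
From mathcomp Require Import all_classical all_reals all_analysis.
From mathcomp Require Import measurable_realfun.
From mathcomp Require Import zify ring lra.
Set Implicit Arguments.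
Unset Strict Implicit.
Unset Printing Implicit Defensive.
Import Order.TTheory GRing.Theory Num.Theory.
Import numFieldNormedType.Exports.
Local Open Scope classical_set_scope.
Local Open Scope ring_scope.

(** * Switchings on disjoint blocks *)

(** A move must change the weight exp(lam Y) by at most a factor 2, and exchanging one row and one
    column of a block changes Y by up to 4 k: E = o(k) enters here, keeping lam k small. The other
    condition makes lam m^2 k^4 / n^2 small, and m^2 k^4 / n^2 is the order of the mean overlap. The
    obstacle is the blocks movable in one direction only. They cost a term of order m k^3 / n^2
    times the mean of Y itself, which must be absorbed on the left. When 2 m k <= n no block is
    stuck. When 2 m k > n and lam n > 1/8, the smallness of lam m^2 k^4 / n^2 forces m k^3 to be a
    small multiple of n^2, so absorption works. What remains is lam n <= 1/8. There one permutes the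
    rows and columns of all blocks at once: disjointness is never broken, and a change of Y by 4 n
    is affordable. Moves act on ordered tuples of blocks, which cover each placement m! times. *)

Section transport.
Variables (R : realType) (X Z : finType) (A : pred X) (W g : X -> R).
Variables (M : Z -> X -> X) (N kappa : R).

(* Count the triples (x, z, M z x) inside A from both ends: the left end bounds
   the number of available moves from below, and the right end is evaluated
   after the substitution x := M z x. *)
Lemma transport :
  (forall z, involutive (M z)) ->
  (forall x, 0 <= W x) -> (forall x, 0 <= g x) -> 
  (forall x z, A x -> A (M z x) -> W (M z x) <= kappa * W x) ->
  (forall x, A x -> g x != 0 -> N <= #|[pred z | A (M z x)]|%:R) ->
  N * \sum_(x | A x) W x * g x <=
  kappa * \sum_(x | A x) W x * \sum_(z | A (M z x)) g (M z x).
Proof.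
move=> MK W0 g0 MW Ng.
apply: (@le_trans _ _ (\sum_(x | A x) \sum_(z | A (M z x)) W x * g x)).
  rewrite mulr_sumr; apply: ler_sum => x Ax.
  have [->|gx] := eqVneq (g x) 0.
    by rewrite !mulr0 sumr_ge0// => z _; rewrite mulr0.
  rewrite sumr_const -[leRHS]mulr_natl ler_wpM2r ?mulr_ge0//.
  exact: Ng.
rewrite (exchange_big_dep predT)//= mulr_sumr.
under [leRHS]eq_bigr do rewrite !mulr_sumr.
rewrite [leRHS](exchange_big_dep predT)//=; apply: ler_sum => z _.
rewrite (reindex_inj (can_inj (MK z))) /=.
under eq_bigl do rewrite MK andbC.
apply: ler_sum => x /andP[Ax AMx].
by rewrite mulrA ler_wpM2r// MW.
Qed.
End transport.

(** * Exchange moves and conflicts between blocks *)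

Section moves.
Local Open Scope set_scope.
Local Open Scope nat_scope.
Variables (n m k : nat).
Implicit Types (Bs : {set block n}) (B : block n) (f : {ffun 'I_m -> block n}) (l q : 'I_m).

(** Transpositions rather than replacements: every move is an involution, as [transport] requires,
    and keeps the side lengths even if the new row or column already belongs to the block. *)
Definition swap_block (i i' j j' : 'I_n) B : block n :=
  (tperm i i' @: B.1, tperm j j' @: B.2).

Definition swap_one l (i i' j j' : 'I_n) f : {ffun 'I_m -> block n} :=
  [ffun q => if q == l then swap_block i i' j j' (f q) else f q].

Definition swap_all (i i' j j' : 'I_n) f : {ffun 'I_m -> block n} :=
  [ffun q => swap_block i i' j j' (f q)].

(** Ordered counterpart of [placements], so that a move can address the [l]-th block. The index is
    unrelated to the labelings. *)
Definition placed (Bs : {set block n}) : pred {ffun 'I_m -> block n} := fun f =>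
  [forall q, f q \in Bs] &&
  [forall p, forall q, (p != q) ==> [disjoint cells (f p) & cells (f q)]].

Lemma placedP Bs f : reflect ((forall q, f q \in Bs) /\
    forall p q a b, p != q -> a \in (f p).1 -> b \in (f p).2 ->
      a \in (f q).1 -> b \in (f q).2 -> False) (placed Bs f).
Proof.
apply: (iffP andP) => -[fB fD]; split.
- by move=> q; exact: (forallP fB).
- move=> p q a b pq ap bp aq bq.
  move: fD => /forallP/(_ p)/forallP/(_ q); rewrite pq /= => /pred0P/(_ (a, b)).
  by rewrite /= !inE /= ap bp aq bq.
- by apply/forallP.
- apply/forallP => p; apply/forallP => q; apply/implyP => pq.
  apply/pred0P => -[a b] /=; apply/negP; rewrite !inE /=.
  by move=> /andP[/andP[ap bp] /andP[aq bq]]; exact: (fD p q a b).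
Qed.

Lemma mem_tperm_imset (i i' x : 'I_n) (S : {set 'I_n}) :
  (x \in tperm i i' @: S) = (tperm i i' x \in S).
Proof. by rewrite -{1}(tpermK i i' x) mem_imset//; exact: perm_inj. Qed.

Lemma swap_blockK i i' j j' : involutive (swap_block i i' j j').
Proof.
move=> [S T]; rewrite /swap_block /=.
by congr pair; apply/setP => x; rewrite !mem_tperm_imset tpermK.
Qed.

Lemma swap_oneK l i i' j j' : involutive (swap_one l i i' j j').
Proof.
by move=> f; apply/ffunP => q; rewrite !ffunE; case: eqP => // _; rewrite swap_blockK.
Qed.

Lemma swap_allK i i' j j' : involutive (swap_all i i' j j').
Proof. by move=> f; apply/ffunP => q; rewrite !ffunE swap_blockK. Qed.

Lemma blocksE B : (B \in blocks n k) = (#|B.1| == k) && (#|B.2| == k).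
Proof. by rewrite inE. Qed.

Lemma swap_block_blocks i i' j j' B :
  (swap_block i i' j j' B \in blocks n k) = (B \in blocks n k).
Proof.
by rewrite !blocksE /= !card_imset//; exact: perm_inj.
Qed.

Lemma mem_swap_cells i i' j j' B c :
  (c \in cells (swap_block i i' j j' B)) =
  ((tperm i i' c.1, tperm j j' c.2) \in cells B).
Proof. by rewrite !inE /= !mem_tperm_imset. Qed.

Lemma placed_swap_all i i' j j' f :
  placed (blocks n k) f -> placed (blocks n k) (swap_all i i' j j' f).
Proof.
move=> /placedP[fB fD]; apply/placedP; split=> [q|p q a b pq].
  by rewrite ffunE swap_block_blocks.
rewrite !ffunE /= !mem_tperm_imset => ap bp aq bq.
exact: (fD p q _ _ pq ap bp aq bq).
Qed.

Definition row_conflicts f l : {set 'I_m} :=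
  [set q | (q != l) && ~~ [disjoint (f q).1 & (f l).1]].
Definition col_conflicts f l : {set 'I_m} :=
  [set q | (q != l) && ~~ [disjoint (f q).2 & (f l).2]].

(* Columns of a block are movable as soon as the blocks sharing one of its rows
   occupy at most half of the columns. *)
Definition cols_free f l := 2 * (k * #|row_conflicts f l|) <= n.
Definition rows_free f l := 2 * (k * #|col_conflicts f l|) <= n.

Definition bad_cols f l := \bigcup_(q in row_conflicts f l) (f q).2.
Definition bad_rows f l := \bigcup_(q in col_conflicts f l) (f q).1.

Lemma mem_row_conflicts f l q a :
  q != l -> a \in (f q).1 -> a \in (f l).1 -> q \in row_conflicts f l.
Proof.
move=> ql aq al; rewrite inE ql /=; apply/pred0Pn; exists a.
by rewrite /= aq al.
Qed.

Lemma mem_col_conflicts f l q a :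
  q != l -> a \in (f q).2 -> a \in (f l).2 -> q \in col_conflicts f l.
Proof.
move=> ql aq al; rewrite inE ql /=; apply/pred0Pn; exists a.
by rewrite /= aq al.
Qed.

Lemma card_bigcup_le (I T : finType) (P : {set I}) (F : I -> {set T}) b :
  (forall i, i \in P -> #|F i| <= b) -> #|\bigcup_(i in P) F i| <= b * #|P|.
Proof.
move=> Fb; rewrite mulnC -sum_nat_const.
apply: (@leq_trans (\sum_(i in P) #|F i|)); last exact: leq_sum.
elim/big_rec2 : _ => [|i s S _ IH]; first by rewrite cards0.
by rewrite (leq_trans (leq_card_setU _ _))// leq_add2l.
Qed.

Lemma card_bad_cols f l :
  placed (blocks n k) f -> #|bad_cols f l| <= k * #|row_conflicts f l|.
Proof.
move=> /placedP[fB _]; apply: card_bigcup_le => q _.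
by have := fB q; rewrite blocksE => /andP[_ /eqP->].
Qed.

Lemma card_bad_rows f l :
  placed (blocks n k) f -> #|bad_rows f l| <= k * #|col_conflicts f l|.
Proof.
move=> /placedP[fB _]; apply: card_bigcup_le => q _.
by have := fB q; rewrite blocksE => /andP[/eqP->].
Qed.

(* Disjoint blocks cannot share both a row and a column, so that every block is
   movable in rows or in columns. *)
Lemma conflicts_disjoint f l :
  placed (blocks n k) f -> #|row_conflicts f l| + #|col_conflicts f l| <= m.
Proof.
move=> /placedP[_ fD]; rewrite -cardsUI.
have -> : row_conflicts f l :&: col_conflicts f l = finset.set0.
  apply/setP => q; rewrite !inE; apply/negP => /andP[/andP[ql]] + /andP[_].
  move=> /pred0Pn[a /andP[aq al]] /pred0Pn[b /andP[bq bl]].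
  exact: (fD q l a b ql aq bq al bl).
by rewrite cards0 addn0 (leq_trans (max_card _))// card_ord.
Qed.

(** Suppose the moved block meets block q at (a, b). If a = i' and b = j', the cell was occupied. If
    only a is new, b is an old column shared with q, so i' is a bad row; symmetrically if only b is
    new. If neither is new, the blocks already met. *)
Lemma placed_swap_one l i i' j j' f : placed (blocks n k) f ->
  i \in (f l).1 -> j \in (f l).2 ->
  i' \notin bad_rows f l -> j' \notin bad_cols f l ->
  (i', j') \notin \bigcup_q cells (f q) ->
  placed (blocks n k) (swap_one l i i' j j' f).
Proof.
move=> pf il jl iR jC ijV; have /placedP[fB fD] := pf.
have H q a b : q != l -> a \in (swap_one l i i' j j' f l).1 ->
   b \in (swap_one l i i' j j' f l).2 -> a \in (f q).1 -> b \in (f q).2 -> False.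
  move=> ql; rewrite ffunE eqxx /= !mem_tperm_imset => al bl aq bq.
  have [ai|ai] := eqVneq a i'; have [bj|bj] := eqVneq b j'.
  - by move/bigcupP: ijV; apply; exists q => //; rewrite !inE /= -ai -bj aq bq.
  - have {}bl : b \in (f l).2 by move: bl; case: tpermP => // [->//|/eqP]; rewrite (negbTE bj).
    by move/bigcupP: iR; apply; exists q; [exact: mem_col_conflicts bq bl|rewrite -ai].
  - have {}al : a \in (f l).1 by move: al; case: tpermP => // [->//|/eqP]; rewrite (negbTE ai).
    by move/bigcupP: jC; apply; exists q; [exact: mem_row_conflicts aq al|rewrite -bj].
  - have {}bl : b \in (f l).2 by move: bl; case: tpermP => // [->//|/eqP]; rewrite (negbTE bj).
    have {}al : a \in (f l).1 by move: al; case: tpermP => // [->//|/eqP]; rewrite (negbTE ai).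
    exact: (fD q l a b).
apply/placedP; split=> [q|p q a b pq].
  by rewrite ffunE; case: eqP => // _; rewrite swap_block_blocks.
have [pl|pl] := eqVneq p l; have [ql|ql] := eqVneq q l.
- by move: pq; rewrite pl ql eqxx.
- by rewrite pl => al bl; rewrite ffunE (negbTE ql) => aq bq; exact: H al bl aq bq.
- rewrite [swap_one _ _ _ _ _ _ p]ffunE (negbTE pl) ql => aq bq al bl.
  exact: H al bl aq bq.
- by rewrite !ffunE (negbTE pl) (negbTE ql); exact: fD.
Qed.

(** Not an instance of [placed_swap_one] with i' = i: no row condition is imposed, so that a block
    without free rows can still move its columns. *)
Lemma placed_swap_col l i j j' f : placed (blocks n k) f ->
  j \in (f l).2 -> j' \notin bad_cols f l ->
  placed (blocks n k) (swap_one l i i j j' f).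
Proof.
move=> pf jl jC; have /placedP[fB fD] := pf.
have H q a b : q != l -> a \in (swap_one l i i j j' f l).1 ->
   b \in (swap_one l i i j j' f l).2 -> a \in (f q).1 -> b \in (f q).2 -> False.
  move=> ql; rewrite ffunE eqxx /= !mem_tperm_imset tperm1 perm1 => al bl aq bq.
  have [bj|bj] := eqVneq b j'.
    by move/bigcupP: jC; apply; exists q; [exact: mem_row_conflicts aq al|rewrite -bj].
  have {}bl : b \in (f l).2 by move: bl; case: tpermP => // [->//|/eqP]; rewrite (negbTE bj).
  exact: (fD q l a b).
apply/placedP; split=> [q|p q a b pq].
  by rewrite ffunE; case: eqP => // _; rewrite swap_block_blocks.
have [pl|pl] := eqVneq p l; have [ql|ql] := eqVneq q l.
- by move: pq; rewrite pl ql eqxx.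
- by rewrite pl => al bl; rewrite ffunE (negbTE ql) => aq bq; exact: H al bl aq bq.
- rewrite [swap_one _ _ _ _ _ _ p]ffunE (negbTE pl) ql => aq bq al bl.
  exact: H al bl aq bq.
- by rewrite !ffunE (negbTE pl) (negbTE ql); exact: fD.
Qed.

(* Among the pairs (i', j') of free rows and columns only those lying in an
   occupied cell are excluded, and there are at most m k ^ 2 <= n ^ 2 / 8. *)
Lemma card_swap_one_ge l i j f : m * k <= n -> 8 * k <= n ->
  placed (blocks n k) f -> i \in (f l).1 -> j \in (f l).2 ->
  rows_free f l -> cols_free f l ->
  n ^ 2 <= 8 * #|[pred z : 'I_n * 'I_n |
                   placed (blocks n k) (swap_one l i z.1 j z.2 f)]|.
Proof.
move=> mkn kn pf il jl; rewrite /rows_free /cols_free => fr fc.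
have br := card_bad_rows l pf; have bc := card_bad_cols l pf.
set V := \bigcup_q cells (f q).
have bV : #|V| <= k ^ 2 * m.
  rewrite /V (eq_bigl (fun q => q \in [set: 'I_m])); last by move=> q; rewrite inE.
  rewrite -[in leqRHS](card_ord m) -cardsT; apply: card_bigcup_le => q _.
  rewrite cardsX; have /placedP[/(_ q)+ _] := pf.
  by rewrite blocksE => /andP[/eqP-> /eqP->]; rewrite mulnn.
pose G := finset.setX (~: bad_rows f l) (~: bad_cols f l) :\: V.
have GE : #|G| <= #|[pred z : 'I_n * 'I_n |
                   placed (blocks n k) (swap_one l i z.1 j z.2 f)]|.
  apply: subset_leq_card; apply/fintype.subsetP => -[a b].
  rewrite !inE /= => /and3P[abV aR bC]; exact: placed_swap_one.
apply: leq_trans (leq_mul (leqnn 8) GE).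
have := subset_leq_card (subsetIr (finset.setX (~: bad_rows f l) (~: bad_cols f l)) V).
have := cardsID V (finset.setX (~: bad_rows f l) (~: bad_cols f l)).
rewrite -/G cardsX.
have := cardsC (bad_rows f l); have := cardsC (bad_cols f l).
rewrite !card_ord.
set x := #|bad_cols f l| in bc *; set y := #|bad_rows f l| in br *.
set x' := #|~: bad_cols f l|; set y' := #|~: bad_rows f l|.
set v := #|V| in bV *; set g := #|G|; move=> hx hy; move: (#|_ :&: V|) => w hg hw.
have h1 : n <= 2 * x' by lia.
have h2 : n <= 2 * y' by lia.
have h3 : n * n <= 4 * (y' * x') by nia.
have h4 : 8 * v <= n * n.
  have : 8 * (k ^ 2 * m) <= n * n.
    by rewrite (_ : 8 * (k ^ 2 * m) = 8 * k * (m * k)) ?leq_mul//; lia.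
  lia.
lia.
Qed.

Lemma card_swap_col_ge l i j f :
  placed (blocks n k) f -> j \in (f l).2 -> cols_free f l ->
  n <= 2 * #|[pred z : 'I_n | placed (blocks n k) (swap_one l i i j z f)]|.
Proof.
move=> pf jl; rewrite /cols_free => fc.
have bc := card_bad_cols l pf.
have : #|~: bad_cols f l| <=
    #|[pred z : 'I_n | placed (blocks n k) (swap_one l i i j z f)]|.
  apply: subset_leq_card; apply/fintype.subsetP => a.
  rewrite !inE /= => aC; exact: placed_swap_col.
have := cardsC (bad_cols f l); rewrite card_ord; lia.
Qed.

End moves.

(** * Transport inequalities for moves of a single block *)

Section weighted_moves.
Variables (R : realType) (n m k : nat) (U : {set 'I_n * 'I_n}).
Variable W : {ffun 'I_m -> block n} -> R.
Implicit Types (f : {ffun 'I_m -> block n}) (l q : 'I_m) (i j t : 'I_n).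
Local Notation P := (placed (blocks n k)).

Hypothesis W0 : forall f, 0 <= W f.
Hypothesis Wswap : forall l i i' j j' f, P f ->
  P (swap_one l i i' j j' f) -> W (swap_one l i i' j j' f) <= 2 * W f.

Definition overlap f l : nat := #|finset.setI U (cells (f l))|.
(** Only the rows of block [l] enter, so this makes sense for every column t and is unchanged when
    the block moves its columns. Likewise [col_mult] looks at the other blocks only. *)
Definition col_overlap f l t : nat := #|[set s in (f l).1 | (s, t) \in U]%SET|.
Definition col_mult f l t : nat := #|[set q | (q != l) && (t \in (f q).2)]%SET|.

Lemma sum_mem (T : finType) (A : {set T}) : \sum_x (x \in A)%:R = #|A|%:R :> R.
Proof.
by rewrite -sumr_const [RHS]big_mkcond /=; apply: eq_bigr => x _; case: ifP.
Qed.

Lemma placed_card f l : P f -> (#|(f l).1| = k) * (#|(f l).2| = k).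
Proof.
by move=> /placedP[/(_ l)+ _]; rewrite blocksE => /andP[/eqP-> /eqP->].
Qed.

(** The cell (i, j) is exchanged with z. It lies in the moved block only if z lay in the old one,
    which leaves k^2 choices of z against at least n^2 / 8 legal moves. The factor 16 is 2 * 8, with
    2 from [Wswap]. *)
Lemma pair_transport l i j : (m * k <= n)%N -> (8 * k <= n)%N ->
  n%:R ^+ 2 * \sum_(f | P f) W f *
    [&& i \in (f l).1, j \in (f l).2, rows_free k f l & cols_free k f l]%:R <=
  16 * k%:R ^+ 2 * \sum_(f | P f) W f.
Proof.
move=> mkn kn.
pose g f : R :=
  [&& i \in (f l).1, j \in (f l).2, rows_free k f l & cols_free k f l]%:R.
pose M (z : 'I_n * 'I_n) f := swap_one l i z.1 j z.2 f.
have MK z : involutive (M z) by exact: swap_oneK.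
have g0 f : 0 <= g f by rewrite ler0n.
have MW f z : P f -> P (M z f) -> W (M z f) <= 2 * W f by exact: Wswap.
have gM f : P f -> g f != 0 -> n%:R ^+ 2 / 8 <= #|[pred z | P (M z f)]|%:R :> R.
  move=> Pf; rewrite /g; case/boolP: [&& _, _, _ & _]; last by rewrite eqxx.
  move=> /and4P[il jl fr fc] _; rewrite ler_pdivrMr// mulrC -natrX -natrM ler_nat.
  exact: card_swap_one_ge.
have H := transport MK W0 g0 MW gM.
rewrite -[leLHS]/(n%:R ^+ 2 * \sum_(f | P f) W f * g f).
suff : \sum_(f | P f) W f * \sum_(z | P (M z f)) g (M z f) <=
    k%:R ^+ 2 * \sum_(f | P f) W f by lra.
rewrite mulr_sumr; apply: ler_sum => f Pf; rewrite mulrC ler_wpM2r//.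
apply: (@le_trans _ _ (\sum_(z : 'I_n * 'I_n) (z \in cells (f l))%:R)).
  rewrite big_mkcond; apply: ler_sum => z _; case: ifP => // _.
  rewrite /g /M ffunE eqxx /= !mem_tperm_imset !tpermL inE ler_nat.
  by do 2?[case: (_ \in _) => //=]; rewrite ?leq_b1.
by rewrite sum_mem cardsX !placed_card// mulnn natrX.
Qed.

Lemma col_overlap_swap l i j j' f t :
  col_overlap (swap_one l i i j j' f) l t = col_overlap f l t.
Proof.
rewrite /col_overlap; congr #|pred_of_set _|; apply/setP => s.
by rewrite !inE ffunE eqxx /= mem_tperm_imset tperm1 perm1.
Qed.

Lemma col_mult_swap l i i' j j' f t :
  col_mult (swap_one l i i' j j' f) l t = col_mult f l t.
Proof.
rewrite /col_mult; congr #|pred_of_set _|; apply/setP => q.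
by rewrite !inE ffunE; case: eqP.
Qed.

(** Moving column t to z preserves both counts at t, and t lies in the moved block only if z lay in
    the old one: k choices of z against at least n / 2 legal moves. *)
Lemma diag_transport l t :
  n%:R * \sum_(f | P f) W f * ((t \in (f l).2) && cols_free k f l)%:R *
    (col_overlap f l t * col_mult f l t)%:R <=
  4 * k%:R * \sum_(f | P f) W f * (col_overlap f l t * col_mult f l t)%:R.
Proof.
pose g f : R := ((t \in (f l).2) && cols_free k f l)%:R *
  (col_overlap f l t * col_mult f l t)%:R.
pose M z f := swap_one l t t t z f.
have MK z : involutive (M z) by exact: swap_oneK.
have g0 f : 0 <= g f by rewrite mulr_ge0.
have MW f z : P f -> P (M z f) -> W (M z f) <= 2 * W f by exact: Wswap.
have gM f : P f -> g f != 0 -> n%:R / 2 <= #|[pred z | P (M z f)]|%:R :> R.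
  move=> Pf; rewrite /g; case/boolP: (_ && _); last by rewrite mul0r eqxx.
  move=> /andP[tl fc] _; rewrite ler_pdivrMr// mulrC -natrM ler_nat.
  exact: card_swap_col_ge.
have H := transport MK W0 g0 MW gM.
under eq_bigr do rewrite -mulrA.
rewrite -[leLHS]/(n%:R * \sum_(f | P f) W f * g f).
suff : \sum_(f | P f) W f * \sum_(z | P (M z f)) g (M z f) <=
    k%:R * \sum_(f | P f) W f * (col_overlap f l t * col_mult f l t)%:R by lra.
rewrite mulr_sumr; apply: ler_sum => f Pf; rewrite mulrCA ler_wpM2l//.
apply: (@le_trans _ _ (\sum_z (z \in (f l).2)%:R *
    (col_overlap f l t * col_mult f l t)%:R)).
  rewrite big_mkcond; apply: ler_sum => z _; case: ifP => [_|_]; last exact: mulr_ge0.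
  rewrite /g /M col_overlap_swap col_mult_swap ler_wpM2r//.
  rewrite ffunE eqxx /= mem_tperm_imset tpermL ler_nat.
  by case: (_ \in _) => //; case: (cols_free _ _ _).
by rewrite -mulr_suml sum_mem placed_card.
Qed.

(** Only t', the column whose multiplicity is counted, is moved. The indicator of t survives on the
    right, so that summing over t there rebuilds the overlap. *)
Lemma offdiag_transport l t t' : t != t' ->
  n%:R * \sum_(f | P f) W f *
    [&& t \in (f l).2, t' \in (f l).2 & cols_free k f l]%:R *
    (col_overlap f l t * col_mult f l t')%:R <=
  4 * k%:R * \sum_(f | P f) W f * (t \in (f l).2)%:R *
    (col_overlap f l t * col_mult f l t')%:R.
Proof.
move=> tt'.
pose g f : R := [&& t \in (f l).2, t' \in (f l).2 & cols_free k f l]%:R *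
  (col_overlap f l t * col_mult f l t')%:R.
pose M z f := swap_one l t' t' t' z f.
have MK z : involutive (M z) by exact: swap_oneK.
have g0 f : 0 <= g f by rewrite mulr_ge0.
have MW f z : P f -> P (M z f) -> W (M z f) <= 2 * W f by exact: Wswap.
have gM f : P f -> g f != 0 -> n%:R / 2 <= #|[pred z | P (M z f)]|%:R :> R.
  move=> Pf; rewrite /g; case/boolP: [&& _, _ & _]; last by rewrite mul0r eqxx.
  move=> /and3P[_ tl fc] _; rewrite ler_pdivrMr// mulrC -natrM ler_nat.
  exact: card_swap_col_ge.
have H := transport MK W0 g0 MW gM.
under eq_bigr do rewrite -mulrA.
under [in leRHS]eq_bigr do rewrite -mulrA.
rewrite -[leLHS]/(n%:R * \sum_(f | P f) W f * g f).
suff : \sum_(f | P f) W f * \sum_(z | P (M z f)) g (M z f) <=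
    k%:R * \sum_(f | P f) W f *
      ((t \in (f l).2)%:R * (col_overlap f l t * col_mult f l t')%:R) by lra.
rewrite mulr_sumr; apply: ler_sum => f Pf; rewrite mulrCA ler_wpM2l//.
apply: (@le_trans _ _ (\sum_z (z \in (f l).2)%:R *
    ((t \in (f l).2)%:R * (col_overlap f l t * col_mult f l t')%:R))).
  rewrite big_mkcond; apply: ler_sum => z _.
  case: ifP => [_|_]; last by rewrite !mulr_ge0.
  rewrite /g /M col_overlap_swap col_mult_swap mulrA ler_wpM2r//.
  rewrite ffunE eqxx /= !mem_tperm_imset tpermL -natrM ler_nat.
  (* When z = t the move exchanges the two columns t and t', and membership of both still gives
     membership of t in the old block. *)
  have [->|zt] := eqVneq z t.
    by rewrite tpermR; do 2?[case: (_ \in _) => //=]; rewrite ?leq_b1.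
  rewrite tpermD 1?eq_sym// 1?eq_sym//.
  by do 2?[case: (_ \in _) => //=]; rewrite ?leq_b1.
by rewrite -mulr_suml sum_mem placed_card.
Qed.

End weighted_moves.

(** * Blocks without free rows *)

Section stuck_blocks.
Variables (R : realType) (n m k : nat).
Implicit Types (U : {set 'I_n * 'I_n}) (W : {ffun 'I_m -> block n} -> R).
Implicit Types (f : {ffun 'I_m -> block n}) (l q : 'I_m) (i j t : 'I_n).
Local Notation P := (placed (blocks n k)).

Definition swap_stable W := forall l i i' j j' f, P f ->
  P (swap_one l i i' j j' f) -> W (swap_one l i i' j j' f) <= 2 * W f.

Definition total_overlap U f : nat := (\sum_l overlap U f l)%N.

Lemma overlapE U f l :
  overlap U f l = (\sum_(t in (f l).2) col_overlap U f l t)%N.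
Proof.
rewrite /overlap -sum1_card (partition_big (@snd _ _) (fun t => t \in (f l).2)) /=.
  apply: eq_bigr => t tl; rewrite sum1_card /col_overlap.
  transitivity #|(fun s => (s, t)) @: [set s in (f l).1 | (s, t) \in U]%SET|%N;
    last by rewrite card_imset// => a b [].
  apply: eq_card => -[a b]; rewrite unfold_in /= !inE /=.
  apply/idP/imsetP => [/andP[/andP[U1 /andP[al bl]] /eqP bt]|[s]].
    by exists a; rewrite -?bt// inE al.
  by rewrite inE => /andP[sl sU] [-> ->]; rewrite sU sl tl eqxx.
by move=> [a b]; rewrite !inE => /and3P[].
Qed.

Lemma sum_col_mult f l : P f -> (\sum_t col_mult f l t <= m * k)%N.
Proof.
move=> Pf; rewrite /col_mult.
under eq_bigr do rewrite -sum1_card.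
under eq_bigr do (under eq_bigl do rewrite inE).
rewrite (exchange_big_dep (fun q => q != l)) /=; last by move=> t q _ /andP[].
apply: (@leq_trans (\sum_(q | q != l) k)).
  apply: leq_sum => q ->/=; rewrite sum1_card.
  have [_ <-] := placed_card q Pf.
  by rewrite leq_eqVlt; apply/orP; left; apply/eqP/eq_card => t.
rewrite sum_nat_const leq_mul2r; apply/orP; right.
by rewrite (leq_trans (max_card _))// card_ord.
Qed.

Lemma col_conflicts_le f l :
  (#|col_conflicts f l| <= \sum_(t in (f l).2) col_mult f l t)%N.
Proof.
rewrite /col_mult.
under eq_bigr do rewrite -sum1_card.
under eq_bigr do (under eq_bigl do rewrite inE).
rewrite (exchange_big_dep (fun q => q != l)) /=; last by move=> t q _ /andP[].
rewrite -sum1_card /col_conflicts.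
rewrite [X in (X <= _)%N](_ : _ = \sum_(q | q != l)
   (~~ [disjoint (f q).2 & (f l).2] : nat))%N; last first.
  under eq_bigl do rewrite inE.
  by rewrite big_mkcondr; apply: eq_bigr => q _; case: ifP.
apply: leq_sum => q ->/=; case: (boolP [disjoint _ & _]) => //= /pred0Pn[t /andP[tq tl]].
rewrite sum1_card; apply/card_gt0P; exists t.
by rewrite unfold_in; apply/andP.
Qed.

Lemma col_overlap_le U f l t : P f -> (col_overlap U f l t <= k)%N.
Proof.
move=> Pf; have [<- _] := placed_card l Pf.
by apply: subset_leq_card; apply/fintype.subsetP => s; rewrite inE => /andP[].
Qed.

(** The row and column conflicts number at most m together, and m k <= n allows only one of the two
    counts to exceed n / (2 k). *)
Lemma rows_stuck_cols_free f l : (m * k <= n)%N -> P f ->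
  ~~ rows_free k f l -> cols_free k f l.
Proof.
move=> mkn Pf; have := conflicts_disjoint l Pf; rewrite /rows_free /cols_free.
by move: (#|_|) (#|_|) => x y h; rewrite -ltnNge; nia.
Qed.

Section bounds.
Variables (U : {set 'I_n * 'I_n}) (W : {ffun 'I_m -> block n} -> R).
Hypothesis W0 : forall f, 0 <= W f.
Hypothesis Wswap : swap_stable W.
Hypothesis mkn : (m * k <= n)%N.

(** On the right of [diag_transport] the column t no longer has to belong to the block, so its
    overlap is simply bounded by k. This produces a term free of Y. *)
Lemma diag_sum : n%:R * \sum_l \sum_t \sum_(f | P f) W f *
    ((t \in (f l).2) && cols_free k f l)%:R *
    (col_overlap U f l t * col_mult f l t)%:R <=
  4 * m%:R ^+ 2 * k%:R ^+ 3 * \sum_(f | P f) W f.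
Proof.
rewrite mulr_sumr.
apply: (@le_trans _ _ (\sum_(l < m) 4 * m%:R * k%:R ^+ 3 * \sum_(f | P f) W f)); last first.
  by rewrite sumr_const card_ord -[X in X <= _]mulr_natr; lra.
apply: ler_sum => l _; rewrite mulr_sumr.
apply: (@le_trans _ _ (\sum_t 4 * k%:R * \sum_(f | P f) W f *
    (col_overlap U f l t * col_mult f l t)%:R)).
  by apply: ler_sum => t _; exact: (diag_transport _ W0 Wswap).
rewrite -mulr_sumr exchange_big /=.
suff : \sum_(f | P f) \sum_t W f * (col_overlap U f l t * col_mult f l t)%:R <=
   k%:R * (m * k)%:R * \sum_(f | P f) W f.
  have k4 : 0 <= 4 * k%:R :> R by rewrite mulr_ge0.
  by move=> /(ler_wpM2l k4); rewrite natrM; lra.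
rewrite [leRHS]mulr_sumr; apply: ler_sum => f Pf.
rewrite -mulr_sumr mulrC ler_wpM2r// -natr_sum -natrM ler_nat.
apply: (@leq_trans (\sum_t k * col_mult f l t)).
  by apply: leq_sum => t _; rewrite leq_mul2r col_overlap_le// orbT.
by rewrite -big_distrr leq_mul2l sum_col_mult// orbT.
Qed.

(** The multiplicities sum to at most m k over t', and the column overlaps over t in the block sum
    to the overlap: Y itself reappears, to be absorbed in [total_overlap_bound]. *)
Lemma offdiag_sum : n%:R * \sum_l \sum_t \sum_(t' | t != t') \sum_(f | P f) W f *
    [&& t \in (f l).2, t' \in (f l).2 & cols_free k f l]%:R *
    (col_overlap U f l t * col_mult f l t')%:R <=
  4 * m%:R * k%:R ^+ 2 * \sum_(f | P f) W f * (total_overlap U f)%:R.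
Proof.
apply: (@le_trans _ _ (\sum_l \sum_t \sum_(t' | t != t') 4 * k%:R *
   \sum_(f | P f) W f * (t \in (f l).2)%:R *
    (col_overlap U f l t * col_mult f l t')%:R)).
  rewrite mulr_sumr; apply: ler_sum => l _; rewrite mulr_sumr; apply: ler_sum => t _.
  rewrite mulr_sumr; apply: ler_sum => t' tt'; exact: (offdiag_transport _ W0 Wswap).
apply: (@le_trans _ _ (\sum_l \sum_t \sum_t' 4 * k%:R *
   \sum_(f | P f) W f * (t \in (f l).2)%:R *
    (col_overlap U f l t * col_mult f l t')%:R)).
  apply: ler_sum => l _; apply: ler_sum => t _.
  rewrite big_mkcond; apply: ler_sum => t' _; case: ifP => // _.
  by rewrite mulr_ge0// sumr_ge0// => f _; rewrite !mulr_ge0.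
under eq_bigr => l _ do under eq_bigr => t _ do rewrite -mulr_sumr.
under eq_bigr => l _ do rewrite -mulr_sumr.
rewrite -mulr_sumr.
suff : \sum_l \sum_t \sum_t' \sum_(f | P f) W f * (t \in (f l).2)%:R *
    (col_overlap U f l t * col_mult f l t')%:R <=
   (m * k)%:R * \sum_(f | P f) W f * (total_overlap U f)%:R.
  have k4 : 0 <= 4 * k%:R :> R by rewrite mulr_ge0.
  by move=> /(ler_wpM2l k4); rewrite natrM; lra.
under eq_bigr => l _ do under eq_bigr => t _ do rewrite exchange_big /=.
under eq_bigr => l _ do rewrite exchange_big /=.
rewrite exchange_big /= mulr_sumr; apply: ler_sum => f Pf.
rewrite /total_overlap natr_sum !mulr_sumr; apply: ler_sum => l _.
rewrite overlapE natr_sum !mulr_sumr [leRHS]big_mkcond; apply: ler_sum => t _ /=.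
rewrite -mulr_sumr -natr_sum; case: ifP => tl; last by rewrite mulr0 mul0r.
rewrite mulr1 mulrCA ler_wpM2l// -natrM ler_nat -big_distrr /= mulnC leq_mul2r.
by rewrite sum_col_mult// orbT.
Qed.

(* A block without free rows shares columns with more than n / (2 k) blocks, so
   its overlap is at most 2 k / n times the sum of its column overlaps c_t times
   the number of conflicts at t'. That sum is small on average, because such a
   block can move its column t' freely. *)
Lemma rows_stuck_bound :
  n%:R ^+ 2 * \sum_(f | P f) W f * \sum_l (~~ rows_free k f l)%:R * (overlap U f l)%:R <=
  8 * m%:R ^+ 2 * k%:R ^+ 4 * \sum_(f | P f) W f +
  8 * m%:R * k%:R ^+ 3 * \sum_(f | P f) W f * (total_overlap U f)%:R.
Proof.
pose Q := \sum_l \sum_t \sum_t' \sum_(f | P f) W f *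
    [&& t \in (f l).2, t' \in (f l).2 & cols_free k f l]%:R *
    (col_overlap U f l t * col_mult f l t')%:R.
have HQ : n%:R * Q <= 4 * m%:R ^+ 2 * k%:R ^+ 3 * \sum_(f | P f) W f +
  4 * m%:R * k%:R ^+ 2 * \sum_(f | P f) W f * (total_overlap U f)%:R.
  apply: le_trans (lerD diag_sum offdiag_sum).
  rewrite -mulrDr ler_wpM2l// /Q -big_split; apply: ler_sum => l _ /=.
  rewrite -big_split; apply: ler_sum => t _ /=.
  rewrite (bigD1 t)//= lerD//.
    by under eq_bigr => f _ do rewrite andbA andbb.
  by under eq_bigl => t' do rewrite eq_sym.
suff : n%:R * \sum_(f | P f) W f *
    \sum_l (~~ rows_free k f l)%:R * (overlap U f l)%:R <= 2 * k%:R * Q.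
  have k2 : 0 <= 2 * k%:R :> R by rewrite mulr_ge0.
  have n0 : 0 <= n%:R :> R by [].
  by move=> /(ler_wpM2l n0); move: HQ => /(ler_wpM2l k2); lra.
rewrite /Q.
under [in leRHS]eq_bigr => l _ do under eq_bigr => t _ do rewrite exchange_big /=.
under [in leRHS]eq_bigr => l _ do rewrite exchange_big /=.
rewrite [in leRHS]exchange_big /= !mulr_sumr; apply: ler_sum => f Pf.
rewrite !mulr_sumr; apply: ler_sum => l _.
case/boolP: (rows_free k f l) => fr.
  rewrite mul0r !mulr0 mulr_ge0// sumr_ge0// => t _.
  by rewrite sumr_ge0// => t' _; rewrite !mulr_ge0.
have fc := rows_stuck_cols_free mkn Pf fr.
rewrite mul1r mulrCA.
rewrite (_ : \sum_t _ = W f * (overlap U f l * \sum_(t' in (f l).2) col_mult f l t')%:R); last first.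
  rewrite overlapE big_distrl natr_sum mulr_sumr [RHS]big_mkcond.
  apply: eq_bigr => t _ /=; case: ifP => tl; last first.
    by rewrite big1// => t' _; rewrite mulr0 mul0r.
  rewrite big_distrr natr_sum mulr_sumr [RHS]big_mkcond.
  apply: eq_bigr => t' _ /=; case: ifP => tl'; last by rewrite mulr0 mul0r.
  by rewrite fc mulr1.
rewrite [leRHS]mulrCA ler_wpM2l// -!natrM ler_nat.
have := col_conflicts_le f l; move: fr; rewrite /rows_free -ltnNge.
move: (#|_|) (\sum_(t' in _) _)%N (overlap U f l) => x y o h1 h2.
have h3 : (n <= 2 * k * y)%N by nia.
by rewrite [leqRHS]mulnCA mulnC leq_mul2l h3 orbT.
Qed.
End bounds.

End stuck_blocks.

(** * Weighted mean of the overlap *)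

Section overlap_bound.
Variables (R : realType) (n m k : nat).
Implicit Types (U : {set 'I_n * 'I_n}) (W : {ffun 'I_m -> block n} -> R).
Implicit Types (B : block n) (f : {ffun 'I_m -> block n}) (l q : 'I_m).
Implicit Types (i j t : 'I_n).
Local Notation P := (placed (blocks n k)).

Definition transpose_blocks f : {ffun 'I_m -> block n} :=
  [ffun q => ((f q).2, (f q).1)].

Lemma transpose_blocksK : involutive transpose_blocks.
Proof. by move=> f; apply/ffunP => q; rewrite !ffunE /=; case: (f q). Qed.

Lemma placed_transpose f : P (transpose_blocks f) = P f.
Proof.
suff H g : P g -> P (transpose_blocks g).
  by apply/idP/idP => /H//; rewrite transpose_blocksK.
move=> /placedP[gB gD]; apply/placedP; split=> [q|p q a b pq].
  by have := gB q; rewrite ffunE !blocksE /= andbC.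
by rewrite !ffunE /= => ap bp aq bq; exact: (gD p q b a).
Qed.

Lemma swap_one_transpose l i i' j j' f :
  swap_one l i i' j j' (transpose_blocks f) =
  transpose_blocks (swap_one l j j' i i' f).
Proof. by apply/ffunP => q; rewrite !ffunE; case: eqP. Qed.

Lemma overlap_transpose U f l :
  overlap [set c | (c.2, c.1) \in U]%SET (transpose_blocks f) l = overlap U f l.
Proof.
rewrite /overlap -(card_imset _ (can_inj (f := fun c : 'I_n * 'I_n => (c.2, c.1))
  (g := fun c => (c.2, c.1)) _)); last by case.
apply: eq_card => -[a b]; apply/imsetP/idP.
  by move=> [[c d]]; rewrite !inE ffunE /= => /and3P[cU cl dl] [-> ->]; rewrite cU cl dl.
by rewrite !inE /= => /and3P[U1 al bl]; exists (b, a) => //; rewrite !inE ffunE /= U1 al bl.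
Qed.

Section weighted.
Variables (U : {set 'I_n * 'I_n}) (W : {ffun 'I_m -> block n} -> R).
Hypothesis W0 : forall f, 0 <= W f.
Hypothesis mkn : (m * k <= n)%N.

(** Transposing every block and [U] exchanges rows and columns, and the weight composed with the
    transposition is again swap stable. *)
Lemma cols_stuck_bound : swap_stable k W ->
  n%:R ^+ 2 * \sum_(f | P f) W f * \sum_l (~~ cols_free k f l)%:R * (overlap U f l)%:R <=
  8 * m%:R ^+ 2 * k%:R ^+ 4 * \sum_(f | P f) W f +
  8 * m%:R * k%:R ^+ 3 * \sum_(f | P f) W f * (total_overlap U f)%:R.
Proof.
move=> Wswap.
have W'swap : swap_stable k (W \o transpose_blocks).
  move=> l i i' j j' f Pf; rewrite -placed_transpose -swap_one_transpose => H.
  by rewrite /= -swap_one_transpose; apply: Wswap => //; rewrite placed_transpose.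
have := rows_stuck_bound [set c | (c.2, c.1) \in U]%SET _ W'swap mkn.
move=> /(_ (fun=> W0 _)).
have reidx (F : _ -> R) : \sum_(f | P f) F f = \sum_(f | P f) F (transpose_blocks f).
  rewrite (reindex_inj (can_inj transpose_blocksK)) /=.
  by apply: eq_bigl => f; rewrite placed_transpose.
set U' := [set c | _]%SET.
have ov f l : overlap U' f l = overlap U (transpose_blocks f) l.
  by rewrite -(overlap_transpose U (transpose_blocks f)) transpose_blocksK.
have -> : \sum_(f | P f) (W \o transpose_blocks) f = \sum_(f | P f) W f.
  exact/esym/reidx.
have -> : \sum_(f | P f) (W \o transpose_blocks) f * (total_overlap U' f)%:R =
    \sum_(f | P f) W f * (total_overlap U f)%:R.
  rewrite [RHS]reidx; apply: eq_bigr => f _; congr (_ * _%:R).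
  by apply: eq_bigr => l _; rewrite ov.
have -> : \sum_(f | P f) (W \o transpose_blocks) f *
    \sum_l (~~ rows_free k f l)%:R * (overlap U' f l)%:R =
    \sum_(f | P f) W f * \sum_l (~~ cols_free k f l)%:R * (overlap U f l)%:R.
  rewrite [RHS]reidx; apply: eq_bigr => f _; congr (_ * _).
  apply: eq_bigr => l _; rewrite ov; congr ((~~ _)%:R * _).
  rewrite /rows_free /cols_free; congr (2 * (_ * #|pred_of_set _|) <= _)%N.
  by apply/setP => q; rewrite !inE !ffunE.
by [].
Qed.

Hypothesis cardU : (#|U| <= m * k ^ 2)%N.

Lemma overlap_sum f l (b : bool) :
  b%:R * (overlap U f l)%:R = \sum_(c in U) ((c \in cells (f l)) && b)%:R :> R.
Proof.
rewrite /overlap -sum1_card natr_sum mulr_sumr [LHS]big_mkcond [RHS]big_mkcond /=.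
apply: eq_bigr => c _; rewrite inE; case: (c \in U) => //=.
by case: (c \in _); rewrite ?mulr1.
Qed.

(** [pair_transport] summed over the m blocks and the at most m k^2 cells of [U]. *)
Lemma movable_bound : swap_stable k W -> (8 * k <= n)%N ->
  n%:R ^+ 2 * \sum_(f | P f) W f * \sum_l (rows_free k f l && cols_free k f l)%:R *
    (overlap U f l)%:R <=
  16 * m%:R ^+ 2 * k%:R ^+ 4 * \sum_(f | P f) W f.
Proof.
move=> Wswap kn.
apply: (@le_trans _ _ (\sum_(l < m) \sum_(c in U) 16 * k%:R ^+ 2 * \sum_(f | P f) W f)); last first.
  rewrite !sumr_const card_ord -mulrnA -[leLHS]mulr_natr natrM.
  have H : #|U|%:R <= m%:R * k%:R ^+ 2 :> R by rewrite -natrX -natrM ler_nat.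
  have S0 : 0 <= 16 * k%:R ^+ 2 * (\sum_(f | P f) W f) * m%:R.
    by rewrite !mulr_ge0// ?exprn_ge0// sumr_ge0.
  by move: H => /(ler_wpM2l S0); lra.
rewrite (_ : \sum_(f | P f) _ = \sum_l \sum_(c in U) \sum_(f | P f) W f *
   [&& c.1 \in (f l).1, c.2 \in (f l).2, rows_free k f l & cols_free k f l]%:R).
  rewrite mulr_sumr; apply: ler_sum => l _; rewrite mulr_sumr; apply: ler_sum => c _.
  exact: pair_transport.
under [RHS]eq_bigr => l _ do rewrite exchange_big /=.
rewrite [RHS]exchange_big /=; apply: eq_bigr => f _; rewrite mulr_sumr.
apply: eq_bigr => l _; rewrite overlap_sum mulr_sumr; apply: eq_bigr => c _.
by case: c => a b; rewrite finset.in_setX -andbA.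
Qed.

(* Only used when lam * n is small: a global swap may change the overlap by 4 n. *)
Lemma swap_all_bound : (0 < n)%N ->
  (forall i i' j j' f, P f -> W (swap_all i i' j j' f) <= 2 * W f) ->
  n%:R ^+ 2 * \sum_(f | P f) W f * (total_overlap U f)%:R <=
  2 * m%:R ^+ 2 * k%:R ^+ 4 * \sum_(f | P f) W f.
Proof.
move=> n0 Wswap.
have H (c : 'I_n * 'I_n) : n%:R ^+ 2 * \sum_(f | P f) W f *
    (\sum_l (c \in cells (f l)))%N%:R <=
  2 * m%:R * k%:R ^+ 2 * \sum_(f | P f) W f.
  pose g f : R := (\sum_l (c \in cells (f l)))%N%:R.
  pose M (z : 'I_n * 'I_n) f := swap_all c.1 z.1 c.2 z.2 f.
  have MK z : involutive (M z) by exact: swap_allK.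
  have g0 f : 0 <= g f by [].
  have MW f z : P f -> P (M z f) -> W (M z f) <= 2 * W f by move=> Pf _; exact: Wswap.
  (* Permuting all blocks together preserves disjointness, so all n^2 moves are legal. *)
  have gM f : P f -> g f != 0 -> n%:R ^+ 2 <= #|[pred z | P (M z f)]|%:R :> R.
    move=> Pf _; rewrite -natrX ler_nat (@leq_trans #|{: 'I_n * 'I_n}|)//.
      by rewrite card_prod !card_ord mulnn.
    by apply: subset_leq_card; apply/fintype.subsetP => z _; rewrite inE placed_swap_all.
  apply: le_trans (transport MK W0 g0 MW gM) _.
  suff : \sum_(f | P f) W f * \sum_(z | P (M z f)) g (M z f) <=
    m%:R * k%:R ^+ 2 * \sum_(f | P f) W f by lra.
  rewrite [leRHS]mulr_sumr; apply: ler_sum => f Pf.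
  rewrite mulrC ler_wpM2r// /g -natr_sum -natrX -natrM ler_nat.
  apply: (@leq_trans (\sum_z \sum_l (z \in cells (f l)))).
    rewrite big_mkcond; apply: leq_sum => z _; case: ifP => // _.
    apply: leq_sum => l _; rewrite ffunE mem_swap_cells !tpermL.
    by case: z.
  rewrite exchange_big /= (eq_bigr (fun=> k ^ 2)%N) => [|l _].
    by rewrite sum_nat_const card_ord.
  have := @sum_mem R _ (cells (f l)); rewrite -natr_sum => /eqP.
  rewrite eqr_nat => /eqP->; rewrite cardsX.
  by have [-> ->] := placed_card l Pf; rewrite mulnn.
apply: (@le_trans _ _ (\sum_(c in U) 2 * m%:R * k%:R ^+ 2 * \sum_(f | P f) W f)).
  rewrite (_ : \sum_(f | P f) _ = \sum_(c in U) \sum_(f | P f) W f *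
    (\sum_l (c \in cells (f l)))%N%:R).
    by rewrite mulr_sumr; apply: ler_sum => c _.
  rewrite exchange_big /=; apply: eq_bigr => f _; rewrite -mulr_sumr; congr (_ * _).
  rewrite /total_overlap natr_sum; under [RHS]eq_bigr do rewrite natr_sum.
  rewrite [RHS]exchange_big /=; apply: eq_bigr => l _.
  have := overlap_sum f l true; rewrite mul1r => ->.
  by apply: eq_bigr => c _; rewrite andbT.
rewrite sumr_const -[leLHS]mulr_natr.
have HU : #|U|%:R <= m%:R * k%:R ^+ 2 :> R by rewrite -natrX -natrM ler_nat.
have S0 : 0 <= 2 * m%:R * k%:R ^+ 2 * (\sum_(f | P f) W f).
  by rewrite !mulr_ge0// ?exprn_ge0// sumr_ge0.
by move: HU => /(ler_wpM2l S0); lra.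
Qed.

(** If 2 m k <= n, every block is free in both directions. Otherwise the movable and stuck
    contributions give 16 + 8 + 8 = 32 times the main term plus 16 m k^3 times the mean of Y. The
    second alternative makes the latter at most half of the left side, and absorbing it doubles 32
    to 64. *)
Lemma total_overlap_bound : swap_stable k W -> (8 * k <= n)%N ->
  (2 * (m * k) <= n)%N \/ (32 * (m * k ^ 3) <= n ^ 2)%N ->
  n%:R ^+ 2 * \sum_(f | P f) W f * (total_overlap U f)%:R <=
  64 * m%:R ^+ 2 * k%:R ^+ 4 * \sum_(f | P f) W f.
Proof.
move=> Wswap kn Hcase.
have SW0 : 0 <= m%:R ^+ 2 * k%:R ^+ 4 * \sum_(f | P f) W f.
  by rewrite !mulr_ge0 ?exprn_ge0// sumr_ge0.
have H1 := movable_bound Wswap kn.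
case: Hcase => [mk2|mk3].
  have E : \sum_(f | P f) W f * (total_overlap U f)%:R =
     \sum_(f | P f) W f * \sum_l (rows_free k f l && cols_free k f l)%:R *
    (overlap U f l)%:R.
    apply: eq_bigr => f Pf; congr (_ * _); rewrite /total_overlap natr_sum.
    apply: eq_bigr => l _; have := conflicts_disjoint l Pf.
    have -> : rows_free k f l && cols_free k f l.
      move: (conflicts_disjoint l Pf); rewrite /rows_free /cols_free.
      by move: (#|_|) (#|_|) => x y h; apply/andP; split; nia.
    by rewrite mul1r.
  by rewrite E; move: H1 SW0; move: (\sum_(f | P f) W f) (\sum_(f | P f) _) => *; lra.
have H2 := rows_stuck_bound U W0 Wswap mkn.
have H3 := cols_stuck_bound Wswap.
set SW := \sum_(f | P f) W f in H1 H2 H3 SW0 *.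
set YW := \sum_(f | P f) W f * (total_overlap U f)%:R in H2 H3 *.
set A1 := \sum_(f | P f) _ in H1; set A2 := \sum_(f | P f) _ in H2.
set A3 := \sum_(f | P f) _ in H3.
have HY : YW <= A1 + A2 + A3.
  rewrite /YW /A1 /A2 /A3 -!big_split /=; apply: ler_sum => f Pf.
  rewrite -!mulrDr ler_wpM2l// /total_overlap natr_sum -!big_split /=.
  apply: ler_sum => l _; rewrite -!mulrDl ler_peMl//.
  by case: rows_free; case: cols_free => /=; lra.
have Y0 : 0 <= YW by apply: sumr_ge0 => f _; rewrite mulr_ge0.
have n20 : 0 <= n%:R ^+ 2 :> R by rewrite exprn_ge0.
have := ler_wpM2l n20 HY; rewrite !mulrDr.
have mk3' : 32 * (m%:R * k%:R ^+ 3) <= n%:R ^+ 2 :> R.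
  by rewrite -!natrX -!natrM ler_nat.
have := ler_wpM2r Y0 mk3'.
by move: H1 H2 H3 SW0; lra.
Qed.
End weighted.
End overlap_bound.

(** * Exponential moment of the overlap of disjoint blocks *)

Section exponential_overlap.
Variables (R : realType) (n m : nat) (U : {set 'I_n * 'I_n}).
Implicit Types (B : block n) (f : {ffun 'I_m -> block n}) (l q : 'I_m).
Implicit Types (i j t : 'I_n) (k : nat).

Lemma expR_le2 (x : R) : x <= 2^-1 -> expR x <= 2.
Proof.
move=> x2; rewrite -[x]opprK expRN.
rewrite -[leRHS]invrK lef_pV2 ?posrE ?expR_gt0 ?invr_gt0//.
by rewrite (le_trans _ (expR_ge1Dx _))//; lra.
Qed.

(** The cells whose membership in a block can change when i is exchanged with i' and j with j'. *)
Definition cross (i i' j j' : 'I_n) : {set 'I_n * 'I_n} :=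
  [set c | (c.1 \in [set i; i']%SET) || (c.2 \in [set j; j']%SET)]%SET.

Lemma card_setI_swap_block i i' j j' B :
  (#|finset.setI U (cells (swap_block i i' j j' B))| <= #|finset.setI U (cells B)| +
   #|finset.setI (cells (swap_block i i' j j' B)) (cross i i' j j')|)%N.
Proof.
apply: leq_trans (leq_card_setU _ _).
apply: subset_leq_card; apply/fintype.subsetP => c.
rewrite finset.in_setI => /andP[cU cB].
rewrite finset.in_setU !finset.in_setI cU cB /=.
case/boolP: (c \in cross i i' j j') => [|cX]; first by rewrite orbT.
rewrite orbF; move: cB cX; rewrite mem_swap_cells !inE !negb_or.
move=> + /andP[/andP[ci ci'] /andP[cj cj']].
by rewrite !tpermD 1?eq_sym.
Qed.

Lemma card_cells_cross k i i' j j' B : (#|B.1| = k)%N -> (#|B.2| = k)%N ->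
  (#|finset.setI (cells B) (cross i i' j j')| <= 4 * k)%N.
Proof.
move=> B1 B2.
apply: (@leq_trans #|finset.setU (finset.setX [set i; i']%SET B.2)
                       (finset.setX B.1 [set j; j']%SET)|).
  apply: subset_leq_card; apply/fintype.subsetP => c.
  rewrite !inE => /andP[/andP[-> ->]]; rewrite andbT.
  by case/orP => ->; rewrite ?orbT.
apply: leq_trans (leq_card_setU _ _) _; rewrite !cardsX B1 B2.
have card2 (a b : 'I_n) : (#|[set a; b]%SET| <= 2)%N by rewrite cards2; case: eqP.
rewrite (_ : 4 * k = 2 * k + k * 2)%N; last by lia.
by rewrite leq_add// leq_mul.
Qed.

Lemma card_cross i i' j j' : (#|cross i i' j j'| <= 4 * n)%N.
Proof.
have := @card_cells_cross n i i' j j' (finset.setT, finset.setT).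
rewrite /= !cardsT card_ord => /(_ erefl erefl); apply: leq_trans.
by apply: subset_leq_card; apply/fintype.subsetP => c cX; rewrite inE cX !inE.
Qed.

Local Notation P := (placed (blocks n _)).

Lemma total_overlap_swap_one k l i i' j j' f : placed (blocks n k) f ->
  (total_overlap U (swap_one l i i' j j' f) <= total_overlap U f + 4 * k)%N.
Proof.
move=> Pf; rewrite /total_overlap (bigD1 l)//= [in leqRHS](bigD1 l)//=.
rewrite addnAC leq_add//; last first.
  by apply: leq_sum => q ql; rewrite /overlap ffunE (negbTE ql).
rewrite /overlap ffunE eqxx (leq_trans (card_setI_swap_block _ _ _ _ _))//.
rewrite leq_add2l; have [S T] := placed_card l Pf.
by apply: card_cells_cross; rewrite card_imset//; exact: perm_inj.
Qed.

(** The swapped blocks are disjoint, so together they meet the cross in at most its 4 n cells,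
    whatever m is. *)
Lemma total_overlap_swap_all k i i' j j' f : placed (blocks n k) f ->
  (total_overlap U (swap_all i i' j j' f) <= total_overlap U f + 4 * n)%N.
Proof.
move=> Pf; apply: (@leq_trans (total_overlap U f +
    \sum_l #|finset.setI (cells (swap_all i i' j j' f l)) (cross i i' j j')|)).
  rewrite /total_overlap -big_split; apply: leq_sum => l _.
  by rewrite /overlap ffunE card_setI_swap_block.
rewrite leq_add2l; apply: leq_trans (card_cross i i' j j').
have /placedP[_ D] := placed_swap_all i i' j j' Pf.
rewrite -sum1_card; under eq_bigr do rewrite -sum1_card.
rewrite (exchange_big_dep (fun c => c \in cross i i' j j')) /=; last first.
  by move=> l c _; rewrite inE => /andP[].
apply: leq_sum => c cX; rewrite sum1_card leqNgt; apply/negP.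
move=> /card_gt1P[p [q [pI qI pq]]].
have cP l : c \in finset.setI (cells (swap_all i i' j j' f l)) (cross i i' j j') ->
    (c.1 \in (swap_all i i' j j' f l).1) && (c.2 \in (swap_all i i' j j' f l).2).
  by rewrite finset.in_setI inE => /andP[].
have /andP[p1 p2] := cP _ pI; have /andP[q1 q2] := cP _ qI.
exact: (D p q c.1 c.2).
Qed.

(** The bound 1/1024 on eps serves three times: 4 lam k <= 1/2 makes the weight swap stable, and for
    lam n > 1/8 it yields both 8 k <= n and the alternative 32 m k^3 <= n^2. *)
Lemma sum_expR_total_overlap k (lam eps : R) : (0 < n)%N -> (m * k <= n)%N ->
  (#|U| <= m * k ^ 2)%N -> 0 <= lam -> eps <= 1024^-1 -> lam * k%:R <= eps ->
  lam * (m%:R ^+ 2 * k%:R ^+ 4) <= eps * n%:R ^+ 2 ->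
  (1 - 64 * eps) *
    \sum_(f : {ffun 'I_m -> block n} | placed (blocks n k) f) expR (lam * (total_overlap U f)%:R) <=
  \sum_(f : {ffun 'I_m -> block n} | placed (blocks n k) f) 1.
Proof.
move=> n0 mkn cardU lam0 eps10 lamk lammk.
pose W f := expR (lam * (total_overlap U f)%:R).
have W0 f : 0 <= W f by exact: expR_ge0.
have Wgrow (x : nat) f f' : (total_overlap U f' <= total_overlap U f + x)%N ->
    lam * x%:R <= 2^-1 -> W f' <= 2 * W f.
  move=> ff' lx; rewrite -[leRHS]mulrC.
  apply: (@le_trans _ _ (W f * expR (lam * x%:R))).
    by rewrite /W -expRD -mulrDr ler_expR ler_wpM2l// -natrD ler_nat.
  by rewrite ler_wpM2l// expR_le2.
have n1 : 0 < n%:R :> R by rewrite ltr0n.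
have eps0 : 0 <= eps by rewrite (le_trans _ lamk)// mulr_ge0.
have Wswap : swap_stable k W.
  move=> l i i' j j' f Pf _; apply: (Wgrow _ _ _ (total_overlap_swap_one _ _ _ _ _ Pf)).
  by rewrite natrM; lra.
set SW := \sum_(f | _) expR _.
have SW0 : 0 <= SW by exact: sumr_ge0.
have main : n%:R ^+ 2 * \sum_(f : {ffun 'I_m -> block n} | placed (blocks n k) f) W f * (total_overlap U f)%:R <=
  64 * m%:R ^+ 2 * k%:R ^+ 4 * SW.
  (* At most 1/8, the change of lam Y under a global swap is at most 4 lam n <= 1/2. *)
  have [ln|ln] := leP (lam * n%:R) 8^-1.
    have Wall i i' j j' f : placed (blocks n k) f ->
        W (swap_all i i' j j' f) <= 2 * W f.
      move=> Pf; apply: (Wgrow _ _ _ (total_overlap_swap_all _ _ _ _ Pf)).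
      by rewrite natrM; lra.
    apply: le_trans (swap_all_bound W0 cardU n0 Wall) _.
    have : 0 <= m%:R ^+ 2 * k%:R ^+ 4 * SW by rewrite !mulr_ge0 ?exprn_ge0.
    by rewrite -/SW; lra.
  have lam1 : 0 < lam by rewrite -(pmulr_lgt0 _ n1); lra.
  apply: total_overlap_bound => //.
    have : lam * (8 * k%:R) <= lam * n%:R by lra.
    by rewrite ler_pM2l// -natrM ler_nat.
  (* If 2 m k > n, then lam m k^3 n <= 2 lam m^2 k^4 <= 2 eps n^2. Dividing by lam n > 1/8 gives m
     k^3 <= 16 eps n^2. *)
  have [|mk2] := leqP (2 * (m * k)) n; [by left|right].
  have mk2' : n%:R <= 2 * (m%:R * k%:R) :> R by rewrite -!natrM ler_nat ltnW.
  suff : 32 * (m%:R * k%:R ^+ 3) <= n%:R ^+ 2 :> R.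
    by rewrite -!natrX -!natrM ler_nat.
  have A0 : 0 <= m%:R * k%:R ^+ 3 :> R by rewrite mulr_ge0 ?exprn_ge0.
  have h1 : lam * (m%:R * k%:R ^+ 3) * n%:R <= 2 * eps * n%:R ^+ 2.
    have : 0 <= lam * (m%:R * k%:R ^+ 3) by rewrite mulr_ge0.
    by move=> /(ler_wpM2l) /(_ _ _ mk2'); lra.
  have h2 : 8^-1 * (m%:R * k%:R ^+ 3) <= lam * n%:R * (m%:R * k%:R ^+ 3).
    by rewrite ler_wpM2r// ltW.
  have n20 : 0 <= n%:R ^+ 2 :> R by rewrite exprn_ge0.
  by have := ler_wpM2r n20 eps10; lra.
have le1 : lam * \sum_(f : {ffun 'I_m -> block n} | placed (blocks n k) f) W f * (total_overlap U f)%:R <=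
    64 * eps * SW.
  have n20 : 0 < n%:R ^+ 2 :> R by rewrite exprn_gt0.
  rewrite -(ler_pM2l n20).
  have := ler_wpM2l lam0 main; have := ler_wpM2r SW0 lammk; lra.
(* exp(u) - u exp(u) <= 1 turns the bound on the weighted mean of the overlap
   into one on the exponential moment. *)
suff : SW - lam * \sum_(f : {ffun 'I_m -> block n} | placed (blocks n k) f) W f * (total_overlap U f)%:R <=
    \sum_(f : {ffun 'I_m -> block n} | placed (blocks n k) f) 1 by lra.
rewrite mulr_sumr -sumrB; apply: ler_sum => f _.
rewrite mulrCA -[X in X - _]mulr1 -mulrBr.
set u := lam * _; apply: (@le_trans _ _ (W f * expR (- u))).
  by rewrite ler_wpM2l// (le_trans _ (expR_ge1Dx _)).
by rewrite /W -expRD subrr expR0.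
Qed.

End exponential_overlap.

(** * Circular placements *)

Section ordered_placements.
Local Open Scope set_scope.
Local Open Scope ring_scope.
Variables (R : realType) (n m : nat) (Bs : {set block n}).
Implicit Types (f : {ffun 'I_m -> block n}) (K : {set block n}).
Hypothesis Bs0 : forall B, B \in Bs -> cells B != finset.set0.

Lemma placed_inj f : placed Bs f -> injective f.
Proof.
move=> /placedP[fB D] p q pq; apply/eqP; apply: contraT => pNq.
have /set0Pn[[a b]] := Bs0 (fB p); rewrite inE => /andP[/= ap bp].
by case: (D p q a b); rewrite // -?pq.
Qed.

Lemma placementsP K : reflect [/\ K \subset Bs, #|K| = m &
    forall B B', B \in K -> B' \in K -> B != B' -> [disjoint cells B & cells B']%B]
  (K \in placements Bs m).
Proof.
rewrite inE; apply: (iffP and3P) => -[KB Km D]; split => //.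
- exact/eqP.
- move=> B B' BK B'K BB'; move/forallP: D => /(_ B)/implyP/(_ BK).
  by move=> /forallP/(_ B')/implyP/(_ B'K)/implyP/(_ BB').
- exact/eqP.
- apply/forallP => B; apply/implyP => BK; apply/forallP => B'; apply/implyP => B'K.
  by apply/implyP; exact: D.
Qed.

Lemma placed_imset f : placed Bs f -> f @: [set: 'I_m]%SET \in placements Bs m.
Proof.
move=> pf; have /andP[/forallP fB /forallP D] := pf; apply/placementsP; split.
- by apply/fintype.subsetP => B /imsetP[q _ ->].
- by rewrite card_imset ?cardsT ?card_ord//; exact: placed_inj.
- move=> _ _ /imsetP[p _ ->] /imsetP[q _ ->] pq.
  by move: (D p) => /forallP/(_ q)/implyP; apply; apply: contraNneq pq => ->.
Qed.

(** The orderings of K are the injections of 'I_m into K: disjoint nonempty blocks are distinct, and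
    an injection is onto because #|K| = m. *)
Lemma card_placed_imset K : K \in placements Bs m ->
  #|[pred f | placed Bs f & f @: [set: 'I_m]%SET == K]| = m`!.
Proof.
move=> /placementsP[KB Km D].
rewrite -ffactnn -[X in X ^_ _]Km -[X in _ ^_ X](card_ord m) -card_inj_ffuns_on.
apply: eq_card => f; rewrite !inE; apply/andP/andP.
  move=> [pf /eqP <-]; split; last by apply/injectiveP; exact: placed_inj.
  by apply/ffun_onP => q; exact: imset_f.
move=> [/ffun_onP fK /injectiveP fI]; split.
  apply/andP; split; first by apply/forallP => q; exact: (fintype.subsetP KB).
  apply/forallP => p; apply/forallP => q; apply/implyP => pq.
  by apply: D => //; apply: contra_neq pq => /fI.
rewrite eqEcard; apply/andP; split.
  by apply/fintype.subsetP => _ /imsetP[q _ ->].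
by rewrite Km card_imset// cardsT card_ord.
Qed.

Lemma sum_placements (F : {set block n} -> R) :
  m`!%:R * \sum_(K in placements Bs m) F K =
  \sum_(f | placed Bs f) F (f @: [set: 'I_m]%SET).
Proof.
rewrite [RHS](partition_big (fun f => f @: [set: 'I_m]%SET)
  (fun K => K \in placements Bs m)) /=; last exact: placed_imset.
rewrite mulr_sumr; apply: eq_bigr => K KP.
rewrite (eq_bigr (fun=> F K)) => [|f /andP[_ /eqP->]//].
rewrite big_const iter_addr addr0 -(card_placed_imset KP) mulr_natl.
by congr (_ *+ _); apply: eq_card.
Qed.

Lemma sum_imset_placed f (y : block n -> R) : placed Bs f ->
  \sum_(B in f @: [set: 'I_m]%SET) y B = \sum_q y (f q).
Proof.
move=> pf; rewrite big_imset /=; last by move=> p q _ _; exact: placed_inj.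
by apply: eq_bigl => q; rewrite inE.
Qed.

End ordered_placements.

Section resampling.
Variables (R : realType) (m : nat) (T : finType) (V : pred {ffun 'I_m -> T}).
Variables (w : T -> R) (q : R).
Implicit Types (f : {ffun 'I_m -> T}) (i j : 'I_m) (b : T).

Definition update j b f : {ffun 'I_m -> T} := [ffun i => if i == j then b else f i].

Lemma updateK j b f : update j (f j) (update j b f) = f.
Proof. by apply/ffunP => i; rewrite !ffunE; case: eqP => [->|]. Qed.

Lemma update_update j b b' f : update j b' (update j b f) = update j b' f.
Proof. by apply/ffunP => i; rewrite !ffunE; case: eqP. Qed.

(* The map (f, b) -> (update j b f, f j) is an involution. *)
Lemma sum_update j (G : {ffun 'I_m -> T} -> R) :
  \sum_f \sum_b G (update j b f) = #|T|%:R * \sum_f G f.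
Proof.
rewrite pair_big /=.
pose phi (x : {ffun 'I_m -> T} * T) := (update j x.2 x.1, x.1 j).
have phiK : involutive phi.
  by move=> [f b]; rewrite /phi /= updateK !ffunE eqxx.
rewrite (reindex_inj (can_inj phiK)) /=.
under eq_bigr => x _ do rewrite updateK.
rewrite -(pair_big predT predT (fun f b => G f)) /= mulr_sumr.
by apply: eq_bigr => f _; rewrite sumr_const mulr_natl.
Qed.

Hypothesis w0 : forall b, 0 <= w b.
Hypothesis q0 : 0 <= q.
Hypothesis wV : forall f j, V f ->
  \sum_(b | V (update j b f)) w b <= (1 + q) * #|[pred b | V (update j b f)]|%:R.

(** The coordinates receive their weight one at a time. Given the others, a coordinate is uniform
    over the values keeping [V], where [w] has mean at most 1 + q, and the weights already present
    do not involve it. *)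
Lemma sum_prod_resample :
  \sum_(f | V f) \prod_i w (f i) <= (1 + q) ^+ m * \sum_(f | V f) 1.
Proof.
(* [sum_update] also runs over f outside [V]. If some value at j repairs f, the hypothesis applies
   to the repaired tuple; otherwise the left sum is empty. *)
have wV' f j :
  \sum_(b | V (update j b f)) w b <= (1 + q) * #|[pred b | V (update j b f)]|%:R.
  have [b Vb|nV] := pickP (fun b => V (update j b f)).
    have := wV j Vb; under eq_bigl do rewrite update_update.
    rewrite (eq_card (_ : _ =i [pred b | V (update j b f)]))// => b'.
    by rewrite !inE update_update.
  by rewrite big_pred0// mulr_ge0// addr_ge0.
suff H (j : nat) : (j <= m)%N ->
    \sum_(f | V f) \prod_(i < m | (i < j)%N) w (f i) <= (1 + q) ^+ j * \sum_(f | V f) 1.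
  have := H m (leqnn m); congr (_ <= _); apply: eq_bigr => f _.
  by apply: eq_bigl => i; rewrite ltn_ord.
elim: j => [_|j IH jm].
  by rewrite mul1r ler_sum// => f _; rewrite big_pred0.
rewrite exprS -mulrA (le_trans _ (ler_wpM2l _ (IH (ltnW jm))))//; last by rewrite addr_ge0.
pose l := Ordinal jm.
have [T0|T0] := posnP #|T|.
  rewrite !big1 ?mulr0// => f; by move: T0 => /eqP; rewrite -leqn0 leqNgt => /negP; case; apply/card_gt0P; exists (f l).
rewrite -(@ler_pM2l _ #|T|%:R) ?ltr0n// mulrCA.
rewrite [X in _ * X <= _]big_mkcond [X in _ <= _ * (_ * X)]big_mkcond /=.
rewrite -!(sum_update l) mulr_sumr; apply: ler_sum => f _.
pose A := \prod_(i < m | (i < j)%N) w (f i).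
have A0 : 0 <= A by exact: prodr_ge0.
have E1 b : \prod_(i < m | (i < j)%N) w (update l b f i) = A.
  apply: eq_bigr => i ij; rewrite ffunE; case: eqP => // il.
  by move: ij; rewrite il ltnn.
have E2 b : \prod_(i < m | (i < j.+1)%N) w (update l b f i) = w b * A.
  rewrite (bigD1 l)//= ffunE eqxx -(E1 b); congr (_ * _); apply: eq_bigl => i.
  by rewrite ltnS -val_eqE /= andbC -ltn_neqAle.
rewrite -!big_mkcond /=.
under eq_bigr do rewrite E2; under [in leRHS]eq_bigr do rewrite E1.
rewrite -mulr_suml sumr_const -mulr_natl mulrA ler_wpM2r//.
Qed.

End resampling.

(** * Circular intervals and blocks *)

Section circular_intervals.
Local Open Scope set_scope.
Local Open Scope nat_scope.
Variables (n m k : nat).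
Implicit Types (a b x : 'I_n) (B : block n) (f : {ffun 'I_m -> block n}).

Definition rot_ord a (e : nat) : 'I_n :=
  Ordinal (ltn_pmod (a + e) (leq_ltn_trans (leq0n a) (ltn_ord a))).

Lemma circular_intervalE a :
  circular_interval k a = [set rot_ord a d | d : 'I_k].
Proof.
apply/setP => x; rewrite inE; apply/existsP/imsetP => [[d /eqP xd]|[d _ ->]].
  by exists d => //; exact: val_inj.
by exists d.
Qed.

Lemma rot_ord_inj a d e : d < n -> e < n -> rot_ord a d = rot_ord a e -> d = e.
Proof.
move=> dn en /(congr1 val) /= /eqP; rewrite eqn_modDl !modn_small//.
by move/eqP.
Qed.

Lemma card_circular_interval a : k <= n -> #|circular_interval k a| = k.
Proof.
move=> kn; rewrite circular_intervalE card_imset ?card_ord// => d e.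
by move=> /rot_ord_inj H; apply: val_inj; apply: H; rewrite (leq_trans (ltn_ord _)).
Qed.

Lemma circular_blockP B :
  reflect (exists a b, B = (circular_interval k a, circular_interval k b))
    (B \in circular_blocks n k).
Proof.
case: B => S T; rewrite inE /=; apply: (iffP andP).
  by move=> [/existsP[a /eqP->] /existsP[b /eqP->]]; exists a, b.
by move=> [a [b [-> ->]]]; split; apply/existsP; [exists a|exists b].
Qed.

Lemma circular_blocks_sub B : k <= n ->
  B \in circular_blocks n k -> B \in blocks n k.
Proof.
move=> kn /circular_blockP[a [b ->]].
by rewrite blocksE /= !card_circular_interval// eqxx.
Qed.

(** Each starting point lies in the other interval, and the two offsets add up to a multiple of n
    that is less than 2 k, hence to 0. *)
Lemma circular_interval_inj : 0 < k -> 2 * k <= n ->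
  injective (@circular_interval n k).
Proof.
move=> k0 kn a b ab.
have aa : a \in circular_interval k b.
  rewrite -ab inE; apply/existsP; exists (Ordinal k0) => /=.
  by rewrite addn0 modn_small.
have bb : b \in circular_interval k a.
  rewrite ab inE; apply/existsP; exists (Ordinal k0) => /=.
  by rewrite addn0 modn_small.
move: aa bb; rewrite !inE => /existsP[[d dk] /= /eqP ad] /existsP[[e ek] /= /eqP be].
have [an bn] := (ltn_ord a, ltn_ord b); apply: val_inj => /=.
have [h1|h1] := ltnP (b + d) n; have [h2|h2] := ltnP (a + e) n.
- by move: ad be; rewrite !modn_small//; lia.
- have E : (a + e) %% n = a + e - n.
    by rewrite -{1}(subnK h2) modnDr modn_small//; lia.
  by move: ad be; rewrite E modn_small//; lia.
- have E : (b + d) %% n = b + d - n.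
    by rewrite -{1}(subnK h1) modnDr modn_small//; lia.
  by move: ad be; rewrite E modn_small//; lia.
- have E : (b + d) %% n = b + d - n.
    by rewrite -{1}(subnK h1) modnDr modn_small//; lia.
  have E' : (a + e) %% n = a + e - n.
    by rewrite -{1}(subnK h2) modnDr modn_small//; lia.
  by move: ad be; rewrite E E'; lia.
Qed.

Lemma card_circular_blocks : 0 < k -> 2 * k <= n -> #|circular_blocks n k| = n ^ 2.
Proof.
move=> k0 kn.
have -> : circular_blocks n k =
  [set (circular_interval k ab.1, circular_interval k ab.2) | ab : 'I_n * 'I_n].
  apply/setP => B; apply/circular_blockP/imsetP => [[a [b ->]]|[[a b] _ ->]].
    by exists (a, b).
  by exists a, b.
rewrite card_imset; first by rewrite card_prod !card_ord mulnn.
by move=> [a b] [c d] /= [/circular_interval_inj-> // /circular_interval_inj->].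
Qed.

Lemma card_meeting_intervals (S : {set 'I_n}) a : k <= n ->
  S = circular_interval k a ->
  #|[set circular_interval k b | b in [pred b |
    ~~ [disjoint circular_interval k b & S]]]| <= 2 * k.
Proof.
move=> kn ->.
(* Meeting intervals start less than k before or after a. Adding n - k to e encodes the shift e - k
   modulo n without negative numbers. *)
apply: (@leq_trans #|[set circular_interval k (rot_ord a (e + (n - k))) | e : 'I_(2 * k)]|).
  apply: subset_leq_card; apply/fintype.subsetP => _ /imsetP[b + ->].
  rewrite inE => /pred0Pn[x /andP[]]; rewrite !inE.
  move=> /existsP[[d dk] /= /eqP xd] /existsP[[e ek] /= /eqP xe].
  have en : e + k - d < 2 * k by lia.
  apply/imsetP; exists (Ordinal en) => //; congr circular_interval.
  apply: val_inj => /=; have := ltn_ord b => bn.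
  have -> : a + (e + k - d + (n - k)) = a + e + (n - d) by lia.
  rewrite -modnDml -xe xd modnDml (_ : b + d + (n - d) = b + n); last by lia.
  by rewrite modnDr modn_small.
by rewrite (leq_trans (leq_imset_card _ _))// card_ord.
Qed.

Lemma card_meeting_blocks B0 : k <= n -> B0 \in circular_blocks n k ->
  #|[set B in circular_blocks n k | ~~ [disjoint cells B & cells B0]]| <= (2 * k) ^ 2.
Proof.
move=> kn /circular_blockP[a [b B0E]].
have := leq_mul (card_meeting_intervals kn (erefl (circular_interval k a)))
                (card_meeting_intervals kn (erefl (circular_interval k b))).
rewrite mulnn; apply: leq_trans; rewrite -cardsX.
apply: subset_leq_card; apply/fintype.subsetP => B; rewrite inE.
move=> /andP[/circular_blockP[c [d ->]]] /pred0Pn[[x y] /andP[]].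
rewrite B0E finset.in_setX /= /cells !finset.in_setX /= => /andP[xc yd] /andP[xa yb].
apply/andP; split; apply/imsetP.
  by exists c => //; rewrite inE; apply/pred0Pn; exists x; rewrite /= xc xa.
by exists d => //; rewrite inE; apply/pred0Pn; exists y; rewrite /= yd yb.
Qed.

(** Nonemptiness of the families, without which the mixture would be the zero measure. The witness
    puts m blocks along the diagonal. *)
Lemma diagonal_placement : 0 < n -> 0 < k -> m * k <= n ->
  exists K, K \in placements (circular_blocks n k) m.
Proof.
move=> n0 k0 mkn.
pose o (p : 'I_m) : 'I_n := insubd (Ordinal n0) (p * k).
have oE p : val (o p) = p * k.
  rewrite val_insubd ifT//; apply: leq_trans mkn.
  by rewrite ltn_pmul2r.
have mem p x : (x \in circular_interval k (o p)) = (p * k <= x < p * k + k).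
  rewrite inE oE; apply/existsP/andP.
    move=> [[d dk] /= /eqP->]; rewrite modn_small; first by lia.
    apply: leq_trans mkn; have := ltn_ord p => pm.
    by apply: (@leq_trans (p.+1 * k)); [rewrite mulSn; lia|rewrite leq_mul2r pm orbT].
  move=> [h1 h2]; have h : x - p * k < k by lia.
  by exists (Ordinal h) => /=; rewrite subnKC// modn_small.
pose g p : block n := (circular_interval k (o p), circular_interval k (o p)).
exists [set g p | p : 'I_m].
have gI : injective g.
  move=> p q [/setP/(_ (o p)) + _]; rewrite !mem oE => /esym H; apply: val_inj => /=.
  have {}H : q * k <= p * k < q * k + k by rewrite H leqnn; lia.
  move: H; case/andP; rewrite leq_pmul2r// => h1.
  by rewrite -mulSnr ltn_pmul2r// ltnS => h2; lia.
apply/placementsP; split.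
- apply/fintype.subsetP => _ /imsetP[p _ ->]; apply/circular_blockP.
  by exists (o p), (o p).
- by rewrite card_imset// card_ord.
move=> _ _ /imsetP[p _ ->] /imsetP[q _ ->] pq.
apply/pred0P => -[x y] /=; apply/negP; rewrite /cells !finset.in_setX /= !mem.
move=> /andP[/andP[/andP[h1 h2] _] /andP[/andP[h3 h4] _]].
move: pq; apply/negP; rewrite negbK; apply/eqP; congr g; apply: val_inj => /=.
have a1 : p < q.+1 by rewrite -(ltn_pmul2r k0) mulSnr; lia.
have a2 : q < p.+1 by rewrite -(ltn_pmul2r k0) mulSnr; lia.
lia.
Qed.

Lemma placements_sub (Bs Bs' : {set block n}) K :
  (forall B, B \in Bs -> B \in Bs') -> K \in placements Bs m -> K \in placements Bs' m.
Proof.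
move=> sub /placementsP[KB Km D]; apply/placementsP; split => //.
by apply/fintype.subsetP => B /(fintype.subsetP KB)/sub.
Qed.

Lemma blocks_nonempty B : 0 < k -> B \in blocks n k -> cells B != finset.set0.
Proof.
move=> k0; rewrite blocksE => /andP[/eqP B1 /eqP B2].
by rewrite -card_gt0 cardsX B1 B2 muln_gt0 k0.
Qed.

End circular_intervals.

(** * Exponential overlap of the supports of two placements *)

Section support_overlap.
Local Open Scope set_scope.
Local Open Scope ring_scope.
Variables (R : realType) (n m k : nat).
Implicit Types (B : block n) (f : {ffun 'I_m -> block n}) (K : {set block n}).

Definition support K : {set 'I_n * 'I_n} := finset.cover [set cells B | B in K].

Lemma mem_support K c : reflect (exists2 B, B \in K & c \in cells B) (c \in support K).
Proof.
rewrite /support cover_imset.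
by apply: (iffP bigcupP) => -[B BK cB]; exists B.
Qed.

Lemma card_support_setI (U : {set 'I_n * 'I_n}) K :
  (#|U :&: support K| <= \sum_(B in K) #|U :&: cells B|)%N.
Proof.
have -> : U :&: support K = \bigcup_(B in K) (U :&: cells B).
  apply/setP => c; rewrite finset.in_setI; apply/andP/bigcupP.
    by move=> [cU /mem_support[B BK cB]]; exists B; rewrite // inE cU cB.
  move=> [B BK]; rewrite inE => /andP[cU cB]; split=> //.
  by apply/mem_support; exists B.
elim/big_rec2 : _ => [|B s S _ IH]; first by rewrite cards0.
by rewrite (leq_trans (leq_card_setU _ _))// leq_add2l.
Qed.

Lemma card_support K : K \in placements (blocks n k) m -> (#|support K| <= m * k ^ 2)%N.
Proof.
move=> /placementsP[KB <- _]; rewrite -[support K]finset.setTI.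
apply: leq_trans (card_support_setI _ _) _.
rewrite -sum_nat_const; apply: leq_sum => B /(fintype.subsetP KB).
by rewrite finset.setTI blocksE cardsX => /andP[/eqP-> /eqP->]; rewrite mulnn.
Qed.

Lemma sum_expR_blocks K (lam eps : R) :
  (0 < n)%N -> (0 < k)%N -> (m * k <= n)%N ->
  0 <= lam -> eps <= 1024^-1 -> lam * k%:R <= eps ->
  lam * (m%:R ^+ 2 * k%:R ^+ 4) <= eps * n%:R ^+ 2 ->
  K \in placements (blocks n k) m ->
  (1 - 64 * eps) * \sum_(K' in placements (blocks n k) m)
     expR (lam * #|support K :&: support K'|%:R) <= #|placements (blocks n k) m|%:R.
Proof.
move=> n0 k0 mkn lam0 eps0 lamk lammk KP.
have Bs0 B : B \in blocks n k -> cells B != finset.set0 by exact: blocks_nonempty.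
have eps1 : 0 <= 1 - 64 * eps by lra.
have H := sum_expR_total_overlap n0 mkn (card_support KP) lam0 eps0 lamk lammk.
have f0 : 0 < m`!%:R :> R by rewrite ltr0n fact_gt0.
rewrite -(ler_pM2l f0) -sum1_card natr_sum sum_placements//.
apply: le_trans H; rewrite mulrCA ler_wpM2l// sum_placements//.
apply: ler_sum => f pf; rewrite ler_expR ler_wpM2l//.
apply: (@le_trans _ _ (\sum_(B in f @: [set: 'I_m]) #|support K :&: cells B|)%N%:R).
  by rewrite ler_nat card_support_setI.
by rewrite natr_sum (sum_imset_placed Bs0)// /total_overlap natr_sum.
Qed.

(* Convexity of exp, averaging the tangent at d * u over the points u and 0. *)
Lemma expR_chord (u d : R) : 0 <= d <= 1 -> expR (d * u) <= 1 - d + d * expR u.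
Proof.
move=> /andP[d0 d1].
have h (v : R) : expR (d * u) * (1 + (v - d * u)) <= expR v.
  rewrite -[v in leRHS](subrKC (d * u)) expRD.
  by rewrite ler_wpM2l ?expR_ge0 ?expR_ge1Dx.
have h1 := h u; have := h 0; rewrite expR0 => h0.
have d1' : 0 <= 1 - d by lra.
have := ler_wpM2l d0 h1; have := ler_wpM2l d1' h0; lra.
Qed.

Definition hits (U : {set 'I_n * 'I_n}) B : bool := ~~ [disjoint cells B & U]%B.

Lemma card_hitting_blocks K : (k <= n)%N -> K \in placements (circular_blocks n k) m ->
  (#|[set B in circular_blocks n k | hits (support K) B]| <= (2 * k) ^ 2 * m)%N.
Proof.
move=> kn /placementsP[KB <- _].
apply: (@leq_trans #|\bigcup_(B0 in K)
    [set B in circular_blocks n k | ~~ [disjoint cells B & cells B0]]|).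
  apply: subset_leq_card; apply/fintype.subsetP => B; rewrite inE.
  move=> /andP[BC /pred0Pn[c /andP[cB /mem_support[B0 B0K cB0]]]].
  apply/bigcupP; exists B0 => //; rewrite inE BC; apply/pred0Pn; exists c.
  by apply/andP.
apply: card_bigcup_le => B0 /(fintype.subsetP KB); exact: card_meeting_blocks.
Qed.

Lemma card_updates f (j : 'I_m) : (0 < k)%N -> (2 * k <= n)%N ->
  placed (circular_blocks n k) f ->
  (n ^ 2 <= #|[pred B | placed (circular_blocks n k) (update j B f)]| + (2 * k) ^ 2 * m)%N.
Proof.
move=> k0 kn pf; have kn' : (k <= n)%N by lia.
have /placedP[fB D] := pf.
rewrite -(card_circular_blocks k0 kn).
pose bad := \bigcup_(q in [set: 'I_m])
    [set B in circular_blocks n k | ~~ [disjoint cells B & cells (f q)]].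
have badb : (#|bad| <= (2 * k) ^ 2 * m)%N.
  rewrite -[X in (_ * X)%N](card_ord m) -cardsT; apply: card_bigcup_le => q _.
  exact: card_meeting_blocks.
rewrite -(cardsID bad (circular_blocks n k)) addnC leq_add//; last first.
  by apply: leq_trans badb; apply: subset_leq_card; exact: finset.subsetIr.
apply: subset_leq_card; apply/fintype.subsetP => B.
rewrite finset.in_setD => /andP[Bbad BC]; rewrite inE.
have H q a b : q != j -> a \in B.1 -> b \in B.2 -> a \in (f q).1 -> b \in (f q).2 -> False.
  move=> qj aB bB aq bq; move/bigcupP: Bbad; apply; exists q; first by rewrite inE.
  rewrite inE BC; apply/pred0Pn; exists (a, b).
  by rewrite /= !inE /= aB bB aq bq.
apply/placedP; split=> [q|p q a b pq]; first by rewrite ffunE; case: eqP.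
rewrite !ffunE; have [pj|pj] := eqVneq p j; have [qj|qj] := eqVneq q j.
- by move: pq; rewrite pj qj eqxx.
- by move=> aB bB aq bq; exact: H qj aB bB aq bq.
- by move=> ap bp aB bB; exact: H pj aB bB ap bp.
- exact: D.
Qed.

(** The excluded positions number at most 4 k^2 m <= n^2 / 2, so A is at least n^2 / 2. *)
Lemma hitting_ratio_nat (A : nat) : (8 * k <= n)%N -> (m * k <= n)%N ->
  (n ^ 2 <= A + (2 * k) ^ 2 * m)%N ->
  ((2 * k) ^ 2 * m * n ^ 2 <= 8 * m * k ^ 2 * A)%N.
Proof.
move=> kn8 mkn HA.
have h1 : ((2 * k) ^ 2 * m * 2 <= n ^ 2)%N.
  rewrite (_ : (2 * k) ^ 2 * m * 2 = 8 * k * (m * k))%N; last by lia.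
  by rewrite -mulnn leq_mul.
have h2 : (n ^ 2 <= 2 * A)%N by lia.
rewrite (_ : 8 * m * k ^ 2 * A = (2 * k) ^ 2 * m * (2 * A))%N; last by lia.
by rewrite leq_mul2l h2 orbT.
Qed.

Lemma side_ratio_nat : (n < 8 * k)%N -> (0 < m)%N -> (n ^ 2 <= 64 * (k ^ 2 * m ^ 2))%N.
Proof.
move=> kn8 m0; apply: (@leq_trans (64 * k ^ 2)); last first.
  by rewrite leq_mul2l /= leq_pmulr// expn_gt0 m0.
by rewrite (_ : 64 = 8 ^ 2)%N// -expnMn leq_exp2r// ltnW.
Qed.

(** A block hitting the support is charged all of its k^2 cells, hence a factor exp(t). Resampling
    then gives (1 + q)^m with q of order (exp(t) - 1) m k^2 / n^2, and the logarithm in the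
    hypothesis is what keeps m q of order d. *)
Lemma sum_expR_circular K (t d : R) :
  (0 < n)%N -> (0 < m)%N -> (0 < k)%N -> (m * k <= n)%N ->
  0 <= t -> 0 <= d <= 1 ->
  t <= d * ln (1 + n%:R ^+ 2 / (k%:R ^+ 2 * m%:R ^+ 2)) ->
  K \in placements (circular_blocks n k) m ->
  \sum_(K' in placements (circular_blocks n k) m)
     expR (t / k%:R ^+ 2 * #|support K :&: support K'|%:R) <=
  expR (512 * d) * #|placements (circular_blocks n k) m|%:R.
Proof.
move=> n0 m0 k0 mkn t0 d01 td KP.
have /andP[d0 d1] := d01.
have kn : (k <= n)%N by apply: leq_trans mkn; rewrite leq_pmull.
have n1 : 0 < n%:R :> R by rewrite ltr0n.
have m1 : 0 < m%:R :> R by rewrite ltr0n.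
have k1 : 0 < k%:R :> R by rewrite ltr0n.
have k2 : 0 < k%:R ^+ 2 :> R by rewrite exprn_gt0.
set y := n%:R ^+ 2 / (k%:R ^+ 2 * m%:R ^+ 2) in td.
have y0 : 0 < y by rewrite divr_gt0 ?mulr_gt0 ?exprn_gt0.
have Bs0 B : B \in circular_blocks n k -> cells B != finset.set0.
  by move=> /(circular_blocks_sub kn); exact: blocks_nonempty.
have hitsE K' : K' \in placements (circular_blocks n k) m ->
    t / k%:R ^+ 2 * #|support K :&: support K'|%:R <=
    t * \sum_(B in K') (hits (support K) B)%:R.
  move=> /placementsP[K'B _ _]; rewrite -mulrA ler_wpM2l// ler_pdivrMl//.
  apply: (@le_trans _ _ (\sum_(B in K') #|support K :&: cells B|)%N%:R).
    by rewrite ler_nat card_support_setI.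
  rewrite natr_sum mulr_sumr; apply: ler_sum => B /(fintype.subsetP K'B).
  move=> /(circular_blocks_sub kn); rewrite blocksE => /andP[/eqP B1 /eqP B2].
  rewrite /hits; case: (boolP [disjoint _ & _]) => [dis|_] /=.
    rewrite mulr0 (_ : #|_| = 0%N)//; apply/eqP; rewrite cards_eq0 finset.setIC.
    by rewrite setI_eq0.
  rewrite mulr1 -natrX ler_nat -mulnn -{1}B1 -B2 -cardsX.
  by apply: subset_leq_card; exact: finset.subsetIr.
apply: (@le_trans _ _ (\sum_(K' in placements (circular_blocks n k) m)
     expR (t * \sum_(B in K') (hits (support K) B)%:R))).
  by apply: ler_sum => K' K'P; rewrite ler_expR hitsE.
(* For n < 8 k there are fewer than 8 blocks and y <= 64, so t <= 64 d and the exponent is at most 8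
   * 64 d: the origin of 512. *)
have [kn8|kn8] := leqP (8 * k) n; last first.
  rewrite -sum1_card natr_sum mulr_sumr; apply: ler_sum => K' K'P.
  rewrite mulr1 ler_expR.
  have m8 : (m < 8)%N by rewrite -(ltn_pmul2r k0) (leq_ltn_trans mkn).
  have : \sum_(B in K') (hits (support K) B)%:R <= 8 :> R.
    have /placementsP[_ K'm _] := K'P.
    apply: (@le_trans _ _ (\sum_(B in K') 1)).
      by apply: ler_sum => B _; rewrite -[leRHS]/(1%:R) ler_nat leq_b1.
    by rewrite sumr_const K'm ler_nat ltnW.
  have t64 : t <= d * 64.
    rewrite (le_trans td)// ler_wpM2l//.
    apply: (@le_trans _ _ y).
      by rewrite le_ln1Dx// (lt_trans _ y0)// ltrN10.
    rewrite /y ler_pdivrMr ?mulr_gt0 ?exprn_gt0//.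
    rewrite -!natrX -!natrM ler_nat.
    exact: side_ratio_nat.
  by move=> /(ler_wpM2l t0); lra.
have f0 : 0 < m`!%:R :> R by rewrite ltr0n fact_gt0.
rewrite -(ler_pM2l f0) mulrCA -[in leRHS]sum1_card natr_sum !sum_placements//.
pose w B := expR (t * (hits (support K) B)%:R).
have e1 : 1 <= expR t by rewrite -expR0 ler_expR.
have wE B : w B = 1 + (expR t - 1) * (hits (support K) B)%:R.
  by rewrite /w; case: hits => /=; rewrite ?mulr1 ?mulr0 ?expR0; lra.
(* At most 4 k^2 m hitting positions out of at least n^2 / 2 available ones. *)
pose q := (expR t - 1) * (8 * m%:R * k%:R ^+ 2 / n%:R ^+ 2).
have q0 : 0 <= q.
  by rewrite mulr_ge0 ?subr_ge0// divr_ge0 ?mulr_ge0 ?exprn_ge0.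
have wV f j : placed (circular_blocks n k) f ->
    \sum_(b | placed (circular_blocks n k) (update j b f)) w b <=
    (1 + q) * #|[pred b | placed (circular_blocks n k) (update j b f)]|%:R.
  move=> pf; have kn2 : (2 * k <= n)%N by apply: leq_trans kn8; rewrite leq_mul2r orbT.
  have HA := card_updates j k0 kn2 pf.
  have HH := card_hitting_blocks kn KP.
  set A := #|_| in HA *; rewrite (eq_bigr _ (fun B _ => wE B)) big_split /=.
  rewrite sumr_const -mulr_sumr [leRHS]mulrDl mul1r lerD//.
  have : \sum_(b | placed (circular_blocks n k) (update j b f))
      (hits (support K) b)%:R <= ((2 * k) ^ 2 * m)%:R :> R.
    rewrite -natr_sum ler_nat; apply: leq_trans HH.
    rewrite -sum1_card big_mkcond [leqRHS]big_mkcond /=; apply: leq_sum => B _.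
    case: ifP => // /placedP[/(_ j)+ _]; rewrite ffunE eqxx => BC.
    by rewrite inE BC /=; case: hits.
  have e0 : 0 <= expR t - 1 by lra.
  move=> /(ler_wpM2l e0) /le_trans; apply.
  rewrite /q -mulrA ler_wpM2l//.
  have n2 : 0 < n%:R ^+ 2 :> R by rewrite exprn_gt0.
  rewrite mulrAC ler_pdivlMr// -!natrX -!natrM ler_nat.
  exact: hitting_ratio_nat.
have w0 B : 0 <= w B by exact: expR_ge0.
have := sum_prod_resample w0 q0 wV.
rewrite (_ : \sum_(f | _) _ = \sum_(f | placed (circular_blocks n k) f)
    expR (t * \sum_(B in f @: [set: 'I_m]) (hits (support K) B)%:R)); last first.
  apply: eq_bigr => f pf; rewrite (sum_imset_placed Bs0)// mulr_sumr.
  by rewrite expR_sum.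
move=> /le_trans; apply; rewrite ler_wpM2r ?sumr_ge0//.
apply: (@le_trans _ _ (expR q ^+ m)).
  by rewrite lerXn2r ?nnegrE ?expR_ge0 ?addr_ge0// expR_ge1Dx.
rewrite -expRM_natl ler_expR.
(* The chord bound at ln (1 + y) reads exp(d ln(1 + y)) <= 1 + d y. With it, m q <= 8 d. *)
have ety : expR t - 1 <= d * y.
  have : expR t <= expR (d * ln (1 + y)) by rewrite ler_expR.
  have := expR_chord (ln (1 + y)) d01; rewrite lnK ?posrE ?addr_gt0//.
  lra.
have : m%:R * q <= m%:R * ((d * y) * (8 * m%:R * k%:R ^+ 2 / n%:R ^+ 2)).
  rewrite ler_pM2l// ler_wpM2r// divr_ge0 ?mulr_ge0 ?exprn_ge0//.
move=> /le_trans; apply.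
rewrite (_ : m%:R * _ = 8 * d); last first.
  rewrite /y; field; rewrite !gt_eqF//.
lra.
Qed.

End support_overlap.

(** * Likelihood ratios *)

Section densities.
Context d (T : measurableType d) (R : realType).
Local Open Scope ereal_scope.
Implicit Types (mu nu : {measure set T -> \bar R}) (g : T -> R).

Definition density nu mu g := [/\ measurable_fun setT g, (forall x, (0 <= g x)%R) &
  forall A, measurable A -> nu A = \int[mu]_(x in A) (g x)%:E].

Import HBNNSimple.

(** Simple functions increasing to F reduce the claim to indicators, with monotone convergence on
    both sides. *)
Lemma density_integral nu mu g (F : T -> \bar R) : density nu mu g ->
  measurable_fun setT F -> (forall x, 0 <= F x) ->
  \int[nu]_x F x = \int[mu]_x (F x * (g x)%:E).
Proof.
move=> [mg g0 nuE] mF F0.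
have mgE : measurable_fun setT (EFin \o g) by exact/measurable_EFinP.
pose h := nnsfun_approx measurableT mF.
have mh n : measurable_fun setT (EFin \o h n) by exact/measurable_EFinP.
have -> : \int[nu]_x F x = limn (fun n => \int[nu]_x (EFin \o h n) x).
  under eq_integral => x _.
    rewrite (_ : F x = limn (fun n => (EFin \o h n) x)); first over.
    by apply/esym/cvg_lim => //; exact: cvg_nnsfun_approx.
  apply: monotone_convergence => //.
  - by move=> n x _ /=; rewrite lee_fin.
  - by move=> x _ a b ab; rewrite lee_fin; exact/lefP/nd_nnsfun_approx.
have -> : \int[mu]_x (F x * (g x)%:E) =
    limn (fun n => \int[mu]_x ((EFin \o h n) x * (g x)%:E)).
  under eq_integral => x _.
    rewrite (_ : F x * _ = limn (fun n => (EFin \o h n) x * (g x)%:E)); first over.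
    by apply/esym/cvg_lim => //; apply: cvgeZr => //; exact: cvg_nnsfun_approx.
  apply: monotone_convergence => //.
  - by move=> n; exact: emeasurable_funM.
  - by move=> n x _ /=; rewrite mule_ge0 ?lee_fin.
  - move=> x _ a b ab /=; rewrite lee_wpmul2r ?lee_fin//.
    exact/lefP/nd_nnsfun_approx.
suff suf n : \int[mu]_x ((EFin \o h n) x * (g x)%:E) = \int[nu]_x (EFin \o h n) x.
  by congr (limn _); apply/funext => n; rewrite suf.
transitivity (\int[nu]_x
   (\sum_(y \in range (h n)) (y * \1_(h n @^-1` [set y]) x)%:E)); last first.
  by apply: eq_integral => t tE; rewrite /= fimfunE -fsumEFin.
have indich m r : measurable_fun setT (fun x => (r * \1_(h m @^-1` [set r]) x)%:E).
  by apply/measurable_EFinP; exact: measurable_funM.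
rewrite ge0_integral_fsum//; last by move=> m y Ey; exact: nnfun_muleindic_ge0.
transitivity (\int[mu]_x (\sum_(y \in range (h n))
    (y * \1_(h n @^-1` [set y]) x)%:E * (g x)%:E)).
  under [RHS]eq_integral => x xE.
    rewrite -ge0_mule_fsuml => [|y]; last exact: nnfun_muleindic_ge0.
    rewrite fsumEFin // -(fimfunE _ x); over.
  by [].
rewrite ge0_integral_fsum//; last 2 first.
  - by move=> y; apply: emeasurable_funM.
  - by move=> m y Ey; rewrite mule_ge0 ?lee_fin// -lee_fin nnfun_muleindic_ge0.
apply: eq_fsbigr => r rhn.
under [RHS]eq_integral do rewrite EFinM.
rewrite integralZl_indic_nnsfun => //.
under eq_integral do rewrite EFinM -muleA.
rewrite ge0_integralZl//.
- under eq_integral do rewrite muleC.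
  rewrite (eq_integral ((EFin \o g) \_ (h n @^-1` [set r]))); last first.
    by move=> x xE; rewrite epatch_indic.
  by rewrite -integral_mkcondr setTI integral_indic// setIT -nuE.
- by apply: emeasurable_funM => //; exact/measurable_EFinP.
- by move=> t Et; rewrite mule_ge0 ?lee_fin.
- by move: rhn; rewrite inE => -[t _ <-]; rewrite lee_fin.
Qed.

(** Converse, by testing on indicators. For product laws the integral form is the one accessible to
    Tonelli. *)
Lemma density_of_integral nu mu g : measurable_fun setT g ->
  (forall x, (0 <= g x)%R) ->
  (forall F : T -> \bar R, measurable_fun setT F -> (forall x, 0 <= F x) ->
    \int[nu]_x F x = \int[mu]_x (F x * (g x)%:E)) -> density nu mu g.
Proof.
move=> mg g0 H; split=> // A mA.
have mA1 : measurable_fun setT (EFin \o \1_A : T -> \bar R).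
  exact/measurable_EFinP.
have := H _ mA1 (fun x => _); rewrite integral_indic// setIT => -> //.
  rewrite [RHS]integral_mkcond; apply: eq_integral => x _ /=.
  by rewrite epatch_indic muleC.
by move=> x /=; rewrite lee_fin.
Qed.

End densities.

(** * Gaussian entries: densities and their correlations *)

Section gaussian_entries.
Variable R : realType.
Implicit Types (sh : shift_model) (x y t : R).
Local Notation RR := (measurableTypeR R).
Local Notation std_normal := (normal_prob 0 1 : probability RR R).

(* The density of entry_law sh x with respect to the standard normal law. *)
Definition entry_ratio sh x : RR -> R := fun t =>
  match sh with
  | MeanShift => expR (x * t - x ^+ 2 / 2)
  | VarianceShift => (Num.sqrt (1 + x))^-1 * expR (t ^+ 2 * (x / (2 * (1 + x))))
  end.

Lemma entry_ratio_ge0 sh x t : 0 <= entry_ratio sh x t.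
Proof. by case: sh => /=; rewrite ?mulr_ge0 ?invr_ge0 ?sqrtr_ge0 ?expR_ge0. Qed.

Lemma measurable_entry_ratio sh x : measurable_fun setT (entry_ratio sh x).
Proof.
case: sh; rewrite /entry_ratio.
  by apply: measurableT_comp => //; apply: measurable_funB.
apply: measurable_funM => //; apply: measurableT_comp => //.
apply: measurable_funM => //; exact: measurable_funX.
Qed.

Lemma normal_pdf_gauss (m s t : R) : s != 0 ->
  normal_pdf m s t = normal_peak s * expR (- (t - m) ^+ 2 / (s ^+ 2 *+ 2)).
Proof. by move=> s0; rewrite normal_pdfE. Qed.

Lemma normal_peak_sqrt (v : R) : 0 < v ->
  normal_peak (Num.sqrt v) = (Num.sqrt v)^-1 * normal_peak 1.
Proof.
move=> v0; rewrite /normal_peak sqr_sqrtr ?ltW// expr1n mul1r -invfM -mulrnAr.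
by rewrite sqrtrM ?ltW.
Qed.

Definition entry_sigma sh x : R :=
  match sh with MeanShift => 1 | VarianceShift => Num.sqrt (1 + x) end.
Definition entry_mean sh x : R :=
  match sh with MeanShift => x | VarianceShift => 0 end.

Definition entry_range sh (theta0 x : R) : Prop :=
  match sh with MeanShift => True | VarianceShift => 0 <= x <= theta0 end.

Lemma normal_pdf_entry_ratio sh theta0 x t : entry_range sh theta0 x ->
  normal_pdf (entry_mean sh x) (entry_sigma sh x) t =
  entry_ratio sh x t * normal_pdf 0 1 t.
Proof.
case: sh => /= [_|/andP[x0 _]].
  rewrite !normal_pdf_gauss ?oner_eq0// mulrCA -expRD; congr (_ * expR _).
  by rewrite expr1n subr0; field.
have x1 : 0 < 1 + x by lra.
rewrite !normal_pdf_gauss ?oner_eq0 ?gt_eqF ?sqrtr_gt0// normal_peak_sqrt//.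
rewrite [RHS]mulrACA -expRD -!mulrA; congr (_ * (_ * expR _)).
rewrite sqr_sqrtr ?ltW// expr1n subr0; field.
by rewrite gt_eqF.
Qed.

Lemma density_normal_lebesgue (m s : R) :
  density (normal_prob m s : probability RR R)
    (lebesgue_measure : {measure set RR -> \bar R}) (normal_pdf m s).
Proof.
split => //; first exact: measurable_normal_pdf.
by move=> x; exact: normal_pdf_ge0.
Qed.

Lemma density_entry_law sh theta0 x : entry_range sh theta0 x ->
  density (entry_law sh x) std_normal (entry_ratio sh x).
Proof.
move=> hx; split; [exact: measurable_entry_ratio|exact: entry_ratio_ge0|].
move=> A mA.
transitivity (normal_prob (entry_mean sh x) (entry_sigma sh x) A).
  by case: sh hx.
rewrite /normal_prob.
rewrite [RHS]integral_mkcond (density_integral (density_normal_lebesgue 0 1)).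
- rewrite [LHS]integral_mkcond; apply: eq_integral => t _ /=.
  rewrite !patchE; case: ifP => _; last by rewrite mul0e.
  by rewrite (normal_pdf_entry_ratio _ hx) EFinM.
- apply/(measurable_restrictT _ mA)/measurable_funTS/measurable_EFinP.
  exact: measurable_entry_ratio.
- move=> t; rewrite patchE; case: ifP => // _; rewrite lee_fin.
  exact: entry_ratio_ge0.
Qed.

(** Completing the square: the integrand times the standard normal density is exp(x y) times the
    density of N(x + y, 1). *)
Lemma integral_entry_ratio_mean x y :
  (\int[std_normal]_t (entry_ratio MeanShift x t * entry_ratio MeanShift y t)%:E =
  (expR (x * y))%:E)%E.
Proof.
rewrite (density_integral (density_normal_lebesgue 0 1)).
- transitivity (\int[lebesgue_measure]_t ((expR (x * y))%:E *
     (normal_pdf (x + y) 1 t)%:E))%E.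
    apply: eq_integral => t _; rewrite -!EFinM; congr EFin => /=.
    rewrite !normal_pdf_gauss ?oner_eq0// [RHS]mulrCA [LHS]mulrCA -!expRD.
    by congr (_ * expR _); rewrite expr1n subr0; field.
  rewrite ge0_integralZl//.
  + by rewrite integral_normal_pdf mule1.
  + by apply/measurable_EFinP; exact: (@measurable_normal_pdf R).
  + by move=> t _; exact: normal_pdf_ge0.
- by apply/measurable_EFinP/measurable_funM; exact: measurable_entry_ratio.
- by move=> t; rewrite lee_fin mulr_ge0// expR_ge0.
Qed.

(** The integrand times the standard normal density is a multiple of a centred normal density of
    variance v, where 1 / v = 1 / (1 + x) + 1 / (1 + y) - 1. Positivity of v needs x y < 1, ensured
    by theta0 < 1. *)
Lemma integral_entry_ratio_variance (theta0 x y : R) : theta0 < 1 ->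
  0 <= x <= theta0 -> 0 <= y <= theta0 ->
  (\int[std_normal]_t (entry_ratio VarianceShift x t *
    entry_ratio VarianceShift y t)%:E = ((Num.sqrt (1 - x * y))^-1)%:E)%E.
Proof.
move=> t1 /andP[x0 xt] /andP[y0 yt].
have x1 : 0 < 1 + x by lra.
have y1 : 0 < 1 + y by lra.
have xy1 : 0 < 1 - x * y by nra.
pose v := (1 + x) * (1 + y) / (1 - x * y).
have v0 : 0 < v by rewrite divr_gt0 ?mulr_gt0.
rewrite (density_integral (density_normal_lebesgue 0 1)).
- transitivity (\int[lebesgue_measure]_t (((Num.sqrt (1 - x * y))^-1)%:E *
     (normal_pdf 0 (Num.sqrt v) t)%:E))%E.
    apply: eq_integral => t _; rewrite -!EFinM; congr EFin => /=.
    rewrite !normal_pdf_gauss ?oner_eq0 ?gt_eqF ?sqrtr_gt0// normal_peak_sqrt//.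
    rewrite !subr0 expr1n sqr_sqrtr ?ltW//.
    set E1 := expR _; set E2 := expR _; set E3 := expR _; set E4 := expR _.
    have -> : E4 = E1 * E2 * E3.
      rewrite /E1 /E2 /E3 /E4 -!expRD; congr expR; rewrite /v; field.
      by rewrite !gt_eqF.
    have sv : Num.sqrt v = Num.sqrt (1 + x) * Num.sqrt (1 + y) / Num.sqrt (1 - x * y).
      rewrite -sqrtrM ?ltW// -sqrtrV ?ltW// -sqrtrM//.
      by rewrite mulr_ge0 ?ltW.
    rewrite sv; have : Num.sqrt (1 - x * y) != 0 by rewrite gt_eqF ?sqrtr_gt0.
    have : Num.sqrt (1 + x) != 0 by rewrite gt_eqF ?sqrtr_gt0.
    have : Num.sqrt (1 + y) != 0 by rewrite gt_eqF ?sqrtr_gt0.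
    move: (Num.sqrt _) (Num.sqrt _) (Num.sqrt _) (normal_peak 1) => a b c p a0 b0 c0.
    by field; rewrite a0 b0 c0.
  rewrite ge0_integralZl//.
  + by rewrite integral_normal_pdf mule1.
  + by apply/measurable_EFinP; exact: (@measurable_normal_pdf R).
  + by move=> t _; exact: normal_pdf_ge0.
- by apply/measurable_EFinP/measurable_funM; exact: measurable_entry_ratio.
- by move=> t; rewrite lee_fin mulr_ge0//; exact: entry_ratio_ge0.
Qed.

(** With w = u / (1 - theta0): sqrt(1 - u) >= 1 - u >= 1 / (1 + w) >= exp(- w). *)
Lemma inv_sqrt_le_expR (theta0 u : R) : 0 <= theta0 < 1 -> 0 <= u <= theta0 ->
  (Num.sqrt (1 - u))^-1 <= expR (u / (1 - theta0)).
Proof.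
move=> /andP[t0 t1] /andP[u0 ut]; have u1 : 0 < 1 - u by lra.
have t1' : 0 < 1 - theta0 by lra.
rewrite -[leRHS]invrK -expRN lef_pV2 ?posrE ?sqrtr_gt0 ?expR_gt0//.
apply: (@le_trans _ _ (1 - u)); last first.
  have s0 := sqrtr_ge0 (1 - u).
  have s1 : Num.sqrt (1 - u) <= 1 by rewrite -[leRHS]sqrtr1 ler_wsqrtr//; lra.
  by have := sqr_sqrtr (ltW u1); nra.
have w0 : 0 <= u / (1 - theta0) by rewrite divr_ge0// ltW.
rewrite expRN; apply: (@le_trans _ _ (1 + u / (1 - theta0))^-1).
  rewrite lef_pV2 ?posrE ?expR_gt0 ?expR_ge1Dx//; lra.
rewrite -[leLHS]mul1r ler_pdivrMr; last by lra.
have : theta0 * (u / (1 - theta0)) >= u * (u / (1 - theta0)) by rewrite ler_wpM2r.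
have -> : theta0 * (u / (1 - theta0)) = u / (1 - theta0) - u.
  by field; rewrite gt_eqF.
lra.
Qed.

(** The quantitative input on the two models. Absolute values are used because mean shifts may be
    negative while only their size is controlled. *)
Lemma entry_chi_bound sh (theta0 : R) : 0 <= theta0 < 1 -> exists2 C : R, 0 <= C &
  forall x y, entry_range sh theta0 x -> entry_range sh theta0 y ->
  (\int[std_normal]_t (entry_ratio sh x t * entry_ratio sh y t)%:E <=
   (expR (C * (`|x| * `|y|)))%:E)%E.
Proof.
move=> /andP[t0 t1]; case: sh => /=.
  exists 1 => // x y _ _; rewrite integral_entry_ratio_mean lee_fin ler_expR mul1r.
  by rewrite -normrM ler_norm.
exists (1 - theta0)^-1; first by rewrite invr_ge0; lra.
move=> x y hx hy; rewrite (integral_entry_ratio_variance t1 hx hy) lee_fin.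
have /andP[x0 xt] := hx; have /andP[y0 yt] := hy.
rewrite !ger0_norm//.
have xy : 0 <= x * y <= theta0 by rewrite mulr_ge0//=; nra.
have t01 : 0 <= theta0 < 1 by rewrite t0.
by have := inv_sqrt_le_expR t01 xy; rewrite [_ / _]mulrC.
Qed.

End gaussian_entries.

(** * Densities and integrals for product laws *)

Section product_densities.
Variable R : realType.
Local Notation RR := (measurableTypeR R).
Local Open Scope ereal_scope.

Lemma measurable_tnth_comp N (i : 'I_N) (h : RR -> R) : measurable_fun setT h ->
  measurable_fun setT (fun t : N.-tuple RR => h (tnth t i)).
Proof. by move=> mh; apply: measurableT_comp => //; exact: measurable_tnth. Qed.

Lemma measurable_tuple_prod N (g : 'I_N -> RR -> R) :
  (forall i, measurable_fun setT (g i)) ->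
  measurable_fun setT (fun t : N.-tuple RR => (\prod_i g i (tnth t i))%R).
Proof.
move=> mg; apply: measurable_prod => i _.
exact: measurable_tnth_comp.
Qed.

Lemma integral_tuple_lawS N (mu : 'I_N.+1 -> probability RR R)
    (F : N.+1.-tuple RR -> \bar R) :
  measurable_fun setT F -> (forall t, 0 <= F t) ->
  \int[tuple_law mu]_t F t =
  \int[mu ord0]_x \int[tuple_law (fun i => mu (lift ord0 i))]_t
    F (pair_to_tuple (x, t)).
Proof.
move=> mF F0.
have mp := @measurable_pair_to_tuple R N.
rewrite [LHS](ge0_integral_pushforward mp)//=.
rewrite preimage_setT (fubini_tonelli1 (F \o @pair_to_tuple R N))//.
- exact: measurableT_comp.
- by move=> x; exact: F0.
Qed.

Lemma measurable_pair_to_tuple1 N (F : N.+1.-tuple RR -> \bar R) x :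
  measurable_fun setT F -> measurable_fun setT (fun t => F (pair_to_tuple (x, t))).
Proof.
move=> mF; apply: (measurableT_comp mF).
apply: measurableT_comp; first exact: measurable_pair_to_tuple.
exact: measurable_pair1.
Qed.

Lemma measurable_integral_pair N (F : N.+1.-tuple RR -> \bar R)
    (nu : probability (N.-tuple RR) R) :
  measurable_fun setT F -> (forall t, 0 <= F t) ->
  measurable_fun setT (fun x => \int[nu]_t F (pair_to_tuple (x, t))).
Proof.
move=> mF F0.
apply: (@measurable_fun_fubini_tonelli_F _ _ _ _ _ nu (F \o @pair_to_tuple R N)) => //.
  by apply: measurableT_comp => //; exact: measurable_pair_to_tuple.
by move=> x; exact: F0.
Qed.

Lemma tuple_prodS N (g : 'I_N.+1 -> RR -> R) x t :
  (\prod_i g i (tnth (pair_to_tuple (x, t)) i) =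
  g ord0 x * \prod_i g (lift ord0 i) (tnth t i))%R.
Proof.
rewrite big_ord_recl; congr (_ * _)%R.
by apply: eq_bigr => i _; rewrite tnthS.
Qed.

(** Tonelli peels off the first coordinate; [density_integral] is then applied to it and, by
    induction, to the rest. *)
Lemma density_tuple_law N (nu mu : 'I_N -> probability RR R) (g : 'I_N -> RR -> R) :
  (forall i, density (nu i) (mu i) (g i)) ->
  density (tuple_law nu) (tuple_law mu) (fun t => \prod_i g i (tnth t i))%R.
Proof.
elim: N nu mu g => [|N IH] nu mu g dg.
  apply: density_of_integral => [||F mF F0].
  - by apply: measurable_tuple_prod => i; case: (dg i).
  - by move=> t; rewrite big_ord0.
  - by apply: eq_integral => t _; rewrite big_ord0 mule1.
have mg i : measurable_fun setT (g i) by case: (dg i).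
have g0 i x : (0 <= g i x)%R by case: (dg i).
apply: density_of_integral => [||F mF F0].
- exact: measurable_tuple_prod.
- by move=> t; apply: prodr_ge0.
have mG : measurable_fun setT
    (fun t : N.+1.-tuple RR => F t * (\prod_i g i (tnth t i))%R%:E).
  apply: emeasurable_funM => //; apply/measurable_EFinP; exact: measurable_tuple_prod.
rewrite !integral_tuple_lawS//; last first.
  by move=> t; rewrite mule_ge0// lee_fin prodr_ge0.
rewrite (density_integral (dg ord0)); last 2 first.
- exact: measurable_integral_pair.
- by move=> x; apply: integral_ge0.
apply: eq_integral => x _.
rewrite (density_integral (IH _ _ _ (fun i => dg (lift ord0 i)))); last 2 first.
- exact: measurable_pair_to_tuple1.
- by move=> t.
rewrite muleC -ge0_integralZl//; last 3 first.
- apply: (emeasurable_funM (measurable_pair_to_tuple1 x mF)).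
  by apply/measurable_EFinP; exact: (measurable_tuple_prod (fun i => mg (lift ord0 i))).
- by move=> t _; rewrite mule_ge0// lee_fin prodr_ge0.
- by rewrite lee_fin.
by apply: eq_integral => t _; rewrite tuple_prodS EFinM muleCA.
Qed.

Lemma integral_tuple_law_prod N (mu : 'I_N -> probability RR R) (h : 'I_N -> RR -> R)
    (c : 'I_N -> R) :
  (forall i, measurable_fun setT (h i)) -> (forall i x, (0 <= h i x)%R) ->
  (forall i, \int[mu i]_x (h i x)%:E <= (c i)%:E) ->
  \int[tuple_law mu]_t (\prod_i h i (tnth t i))%R%:E <= (\prod_i c i)%R%:E.
Proof.
elim: N mu h c => [|N IH] mu h c mh h0 hc.
  rewrite big_ord0 (eq_integral (cst 1)); last by move=> t _; rewrite big_ord0.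
  by rewrite integral_cst// mul1e probability_le1.
have c0 i : (0 <= c i)%R.
  by rewrite -lee_fin (le_trans _ (hc i))// integral_ge0// => x _; rewrite lee_fin.
rewrite integral_tuple_lawS; last 2 first.
- apply/measurable_EFinP; exact: measurable_tuple_prod.
- by move=> t; rewrite lee_fin prodr_ge0.
rewrite big_ord_recl.
have C0 : (0 <= \prod_(i < N) c (lift ord0 i))%R by apply: prodr_ge0.
apply: (@le_trans _ _ (\int[mu ord0]_x ((\prod_(i < N) c (lift ord0 i))%R%:E *
    (h ord0 x)%:E))); last first.
  rewrite ge0_integralZl//.
  - by rewrite [leRHS]EFinM [leRHS]muleC lee_wpmul2l ?lee_fin//; exact: hc.
  - exact/measurable_EFinP.
  - by move=> x _; rewrite lee_fin.
apply: ge0_le_integral => //.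
- by move=> x _; apply: integral_ge0 => t _; rewrite lee_fin prodr_ge0.
- by apply: (measurable_integral_pair (F := fun t => (\prod_i h i (tnth t i))%R%:E));
    [apply/measurable_EFinP; exact: measurable_tuple_prod|
     move=> t; rewrite lee_fin prodr_ge0].
- by apply: emeasurable_funM => //; exact/measurable_EFinP.
move=> x _.
under eq_integral do rewrite tuple_prodS EFinM.
rewrite ge0_integralZl//; last 3 first.
- by apply/measurable_EFinP; exact: (measurable_tuple_prod (fun i => mh (lift ord0 i))).
- by move=> t _; rewrite lee_fin prodr_ge0.
- by rewrite lee_fin.
rewrite muleC lee_wpmul2r ?lee_fin//.
by apply: (IH _ (fun i => h (lift ord0 i)) (fun i => c (lift ord0 i))) => i //; exact: hc.
Qed.

End product_densities.

Section matrix_densities.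
Variables (R : realType) (n : nat).
Local Notation RR := (measurableTypeR R).
Local Open Scope ereal_scope.
Implicit Types (c : 'I_n * 'I_n).

Lemma measurable_entry c :
  measurable_fun setT (fun X : observation R n => (X : 'M[R]_n) c.1 c.2 : RR).
Proof.
move=> _ A mA; rewrite setTI; apply: sub_sigma_algebra.
by exists c, A.
Qed.

Lemma measurable_entry_prod (g : 'I_n * 'I_n -> RR -> R) :
  (forall c, measurable_fun setT (g c)) ->
  measurable_fun setT
    (fun X : observation R n => (\prod_c g c ((X : 'M[R]_n) c.1 c.2))%R).
Proof.
move=> mg; apply: measurable_prod => c _.
by apply: (measurableT_comp (mg c)); exact: measurable_entry.
Qed.

Lemma tuple_to_matrix_prod (g : 'I_n * 'I_n -> RR -> R) t :
  (\prod_c g c ((tuple_to_matrix t : 'M[R]_n) c.1 c.2) =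
   \prod_l g (enum_val l) (tnth t l))%R.
Proof.
rewrite (reindex _ (onW_bij _ (@enum_val_bij ('I_n * 'I_n)%type))) /=.
by apply: eq_bigr => l _; rewrite mxE -surjective_pairing enum_valK.
Qed.

Lemma integral_independent_law (mu : 'I_n * 'I_n -> probability RR R)
    (F : observation R n -> \bar R) :
  measurable_fun setT F -> (forall X, 0 <= F X) ->
  \int[independent_law mu]_X F X =
  \int[tuple_law (fun l => mu (enum_val l))]_t F (tuple_to_matrix t).
Proof.
move=> mF F0.
by rewrite (ge0_integral_pushforward (@measurable_tuple_to_matrix R n)).
Qed.

Lemma density_independent_law (nu mu : 'I_n * 'I_n -> probability RR R)
    (g : 'I_n * 'I_n -> RR -> R) : (forall c, density (nu c) (mu c) (g c)) ->
  density (independent_law nu) (independent_law mu)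
    (fun X => \prod_c g c ((X : 'M[R]_n) c.1 c.2))%R.
Proof.
move=> dg.
have mg c : measurable_fun setT (g c) by case: (dg c).
have g0 c x : (0 <= g c x)%R by case: (dg c).
have mG := measurable_entry_prod mg.
apply: density_of_integral => // [X|F mF F0]; first exact: prodr_ge0.
rewrite !integral_independent_law//; last 2 first.
- by apply: emeasurable_funM => //; exact/measurable_EFinP.
- by move=> X; rewrite mule_ge0// lee_fin prodr_ge0.
rewrite (density_integral (density_tuple_law (fun l => dg (enum_val l)))).
- by apply: eq_integral => t _; rewrite tuple_to_matrix_prod.
- by apply: (measurableT_comp mF); exact: measurable_tuple_to_matrix.
- by move=> t.
Qed.

Lemma integral_independent_prod (mu : 'I_n * 'I_n -> probability RR R)
    (h : 'I_n * 'I_n -> RR -> R) (b : 'I_n * 'I_n -> R) :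
  (forall c, measurable_fun setT (h c)) -> (forall c x, (0 <= h c x)%R) ->
  (forall c, \int[mu c]_x (h c x)%:E <= (b c)%:E) ->
  \int[independent_law mu]_X (\prod_c h c ((X : 'M[R]_n) c.1 c.2))%R%:E <=
  (\prod_c b c)%R%:E.
Proof.
move=> mh h0 hb.
rewrite integral_independent_law; last 2 first.
- by apply/measurable_EFinP; exact: measurable_entry_prod.
- by move=> X; rewrite lee_fin prodr_ge0.
under eq_integral do rewrite tuple_to_matrix_prod.
rewrite (reindex _ (onW_bij _ (@enum_val_bij ('I_n * 'I_n)%type))) /=.
exact: (integral_tuple_law_prod (fun l => mh (enum_val l))
  (fun l => h0 (enum_val l)) (fun l => hb (enum_val l))).
Qed.

End matrix_densities.

(** * Densities of uniform mixtures *)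

Section mixture_densities.
Context d (T : measurableType d) (R : realType).
Variables (J : finType) (A : {set J}).
Implicit Types (mu : {measure set T -> \bar R}) (g : J -> T -> R).
Local Open Scope ereal_scope.

Definition average g : T -> R := fun x => (#|A|%:R^-1 * \sum_(j in A) g j x)%R.

Lemma measurable_average g : (forall j, j \in A -> measurable_fun setT (g j)) ->
  measurable_fun setT (average g).
Proof.
move=> mg; rewrite /average; apply: measurable_funM => //.
under eq_fun do rewrite big_mkcond /=.
by apply: measurable_sum => j; case: (boolP (j \in A)) => [|_]; [exact: mg|exact: measurable_cst].
Qed.

Lemma average_ge0 g x : (forall j, j \in A -> (0 <= g j x)%R) -> (0 <= average g x)%R.
Proof. by move=> g0; rewrite mulr_ge0 ?invr_ge0 ?sumr_ge0. Qed.

Lemma integral_average mu g (D : set T) : measurable D ->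
  (forall j, j \in A -> measurable_fun setT (g j)) ->
  (forall j x, j \in A -> (0 <= g j x)%R) ->
  \int[mu]_(x in D) (average g x)%:E =
  (#|A|%:R^-1)%:E * \sum_(j in A) \int[mu]_(x in D) (g j x)%:E.
Proof.
move=> mD mg g0; rewrite /average.
(* Nothing is assumed about [g j] for j outside A; extending by 0 makes all indices measurable and
   nonnegative. *)
pose g' j x := if j \in A then g j x else 0%R.
have mg' j : measurable_fun D (EFin \o g' j).
  apply/measurable_EFinP/measurable_funTS; rewrite /g'.
  by case: (boolP (j \in A)) => // jA; exact: mg.
have g'0 j x : 0 <= (g' j x)%:E.
  by rewrite lee_fin /g'; case: ifPn => // jA; exact: g0.
transitivity (\int[mu]_(x in D) ((#|A|%:R^-1)%:E *
    \sum_(j <- index_enum J) (g' j x)%:E)).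
  apply: eq_integral => x _; rewrite EFinM -sumEFin big_mkcond /=.
  by congr (_ * _); apply: eq_bigr => j _; rewrite /g'; case: ifP.
rewrite ge0_integralZl//; last 2 first.
- exact: emeasurable_sum.
- by move=> x _; exact: sume_ge0.
rewrite ge0_integral_sum// [in RHS]big_mkcond /=; congr (_ * _).
apply: eq_bigr => j _; rewrite /g'; case: ifP => // jA.
by rewrite integral0.
Qed.

Lemma density_uniform_mixture mu (P : J -> {finite_measure set T -> \bar R}) g :
  (forall j, j \in A -> density (P j) mu (g j)) ->
  density (uniform_mixture A P) mu (average g).
Proof.
move=> dg; split.
- by apply: measurable_average => j /dg[].
- by move=> x; apply: average_ge0 => j /dg[].
move=> E mE; rewrite integral_average//; last 2 first.
- by move=> j /dg[].
- by move=> j x /dg[].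
by congr (_ * _); apply: eq_bigr => j /dg[_ _ ->].
Qed.

(** Used on one factor of a product of mixtures at a time, the other factor being h; this expands a
    second moment over pairs of placements and of labelings. *)
Lemma integral_averageM_le mu g (h : T -> R) (b : J -> R) :
  (forall j, j \in A -> measurable_fun setT (g j)) ->
  (forall j x, j \in A -> (0 <= g j x)%R) ->
  measurable_fun setT h -> (forall x, (0 <= h x)%R) ->
  (forall j, j \in A -> \int[mu]_x (g j x * h x)%:E <= (b j)%:E) ->
  \int[mu]_x (average g x * h x)%:E <= (#|A|%:R^-1 * \sum_(j in A) b j)%:E.
Proof.
move=> mg g0 mh h0 gb.
under eq_integral => x _.
  rewrite (_ : (average g x * h x)%R = average (fun j y => g j y * h y)%R x); first over.
  by rewrite /average -mulrA mulr_suml.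
rewrite integral_average//; last 2 first.
- by move=> j jA; apply: measurable_funM => //; exact: mg.
- by move=> j x jA; rewrite mulr_ge0// g0.
rewrite EFinM -sumEFin lee_wpmul2l ?lee_fin ?invr_ge0//.
exact: lee_sum.
Qed.

End mixture_densities.

(** * Total variation and the second moment of the likelihood ratio *)

Section dTV_bound.
Context d (T : measurableType d) (R : realType).
Variables (P : probability T R) (Q : {finite_measure set T -> \bar R}) (L : T -> R).
Local Open Scope ereal_scope.
Hypothesis QP : density Q P L.

Let mL : measurable_fun setT L. Proof. by case: QP. Qed.
Let L0 x : (0 <= L x)%R. Proof. by case: QP. Qed.

(** The variation is P - Q on the positive Hahn set and Q - P on the negative one, and the integral
    of |1 - L| dominates both on every measurable set. So the choice of decomposition is
    immaterial. *)
Lemma dTV_le_integral : dTV P Q <= 2^-1%:E * \int[P]_x `|1 - L x|%:E.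
Proof.
rewrite /dTV; move: (cid _) => [A HA] /=; move: (cid _) => [B AB] /=.
rewrite lee_wpmul2l ?lee_fin ?invr_ge0//.
have [[mA _] [mB _] ABT AB0] := AB.
have mabs : measurable_fun setT (fun x => `|1 - L x|%:E).
  apply/measurable_EFinP; apply: measurableT_comp => //.
  exact: measurable_funB.
have mLE : measurable_fun setT (fun x => (L x)%:E) by exact/measurable_EFinP.
have PE D : measurable D -> P D = \int[P]_(x in D) (cst 1 x).
  by move=> mD; rewrite integral_cst// mul1e.
have QE D : measurable D -> Q D = \int[P]_(x in D) (L x)%:E.
  by move=> mD; case: QP => _ _ ->.
have finQ D : measurable D -> Q D \is a fin_num by exact: fin_num_measure.
have finP D : measurable D -> P D \is a fin_num by exact: fin_num_measure.
have h1 D : measurable D -> P D - Q D <= \int[P]_(x in D) `|1 - L x|%:E.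
  move=> mD; rewrite leeBlDr ?finQ// QE// PE// -ge0_integralD//; last 3 first.
  - exact: measurable_funTS.
  - by move=> x _; rewrite lee_fin.
  - exact: measurable_funTS.
  apply: ge0_le_integral => //.
  - by apply: emeasurable_funD; exact: measurable_funTS.
  - move=> x _; rewrite /cst -EFinD lee_fin.
    by rewrite -lerBlDr ler_norm.
have h2 D : measurable D -> Q D - P D <= \int[P]_(x in D) `|1 - L x|%:E.
  move=> mD; rewrite leeBlDr ?finP// QE// PE// -ge0_integralD//; last first.
    exact: measurable_funTS.
  apply: ge0_le_integral => //.
  - by move=> x _; rewrite lee_fin.
  - exact: measurable_funTS.
  - by apply: emeasurable_funD => //; exact: measurable_funTS.
  - move=> x _; rewrite /cst -EFinD lee_fin.
    by rewrite -lerBlDr -normrN opprB ler_norm.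
have -> : \int[P]_x `|1 - L x|%:E =
    \int[P]_(x in A) `|1 - L x|%:E + \int[P]_(x in B) `|1 - L x|%:E.
  rewrite -ABT ge0_integral_setU//; first exact: measurable_funTS.
  by rewrite disj_set2E AB0.
rewrite /charge_variation /=; apply: leeD.
  rewrite jordan_posE cjordan_posE /crestr0 mem_set// /crestr setTI.
  exact: h1.
rewrite jordan_negE cjordan_negE /crestr0 mem_set// /crestr setTI.
suff -> : - difference_charge P Q B = Q B - P B by exact: h2.
have -> : difference_charge P Q B = P B - Q B by [].
by rewrite -(fineK (finP _ mB)) -(fineK (finQ _ mB)) -!EFinB -EFinN opprB.
Qed.

(** The pointwise bound |z| <= delta + z^2 / delta replaces Cauchy-Schwarz, and the integral of (1 -
    L)^2 is at most eta because L has mean 1. *)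
Lemma dTV_chi2 (eta delta : R) : (0 < delta)%R -> Q setT = 1 ->
  \int[P]_x (L x * L x)%:E <= (1 + eta)%:E ->
  dTV P Q <= (delta + eta / delta)%:E.
Proof.
move=> d0 Q1 Leta; apply: le_trans dTV_le_integral _.
have mLE : measurable_fun setT (fun x => (L x)%:E) by exact/measurable_EFinP.
have mLL : measurable_fun setT (fun x => (L x * L x)%:E).
  by apply/measurable_EFinP; exact: measurable_funM.
have mabs : measurable_fun setT (fun x => `|1 - L x|%:E).
  apply/measurable_EFinP; apply: measurableT_comp => //.
  exact: measurable_funB.
have msq : measurable_fun setT (fun x => ((1 - L x) ^+ 2)%:E).
  by apply/measurable_EFinP; apply: measurable_funX; exact: measurable_funB.
have P1 : \int[P]_x cst 1 x = 1 by rewrite integral_cst// mul1e; exact: probability_setT.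
have L1 : \int[P]_x (L x)%:E = 1 by case: QP => _ _ <-.
have sq0 x : 0 <= ((1 - L x) ^+ 2)%:E by rewrite lee_fin sqr_ge0.
have Lge0 x : 0 <= (L x)%:E by rewrite lee_fin.
have LLge0 x : 0 <= (L x * L x)%:E by rewrite lee_fin mulr_ge0.
have sq : \int[P]_x ((1 - L x) ^+ 2)%:E <= eta%:E.
  (* (1 - L)^2 + L + L = L^2 + 1 integrated: only nonnegative integrands, hence no subtraction of
     extended reals. *)
  have E : \int[P]_x ((1 - L x) ^+ 2)%:E + (1 + 1) =
      \int[P]_x (L x * L x)%:E + 1.
    rewrite -{1 2}L1 -P1 -!ge0_integralD//.
    - by apply: eq_integral => x _; rewrite /cst -!EFinD; congr EFin; ring.
    - by move=> x _; exact: adde_ge0.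
    - exact: emeasurable_funD.
  have : \int[P]_x ((1 - L x) ^+ 2)%:E + (1 + 1) <= (1 + eta)%:E + 1.
    by rewrite E leeD2r.
  rewrite -leeBrDr// => /le_trans; apply.
  by rewrite -!EFinD -?EFinN -?EFinB -?EFinD lee_fin; lra.
have dV0 : (0 <= delta^-1)%R by rewrite invr_ge0 ltW.
have amgm : \int[P]_x `|1 - L x|%:E <= (delta + eta / delta)%:E.
  apply: (@le_trans _ _ (\int[P]_x (delta%:E * cst 1 x +
      (delta^-1)%:E * ((1 - L x) ^+ 2)%:E))).
    apply: ge0_le_integral => //.
    - by apply: emeasurable_funD => //; exact: emeasurable_funM.
    - move=> x _; rewrite mule1 -EFinM -EFinD lee_fin -real_normK ?num_real//.
      rewrite mulrC -subr_ge0.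
      have z0 := normr_ge0 (1 - L x)%R; move: (`|1 - L x|%R) z0 => z z0.
      have h : (z * delta <= delta ^+ 2 + z ^+ 2)%R by nra.
      have : ((z * delta) / delta <= (delta ^+ 2 + z ^+ 2) / delta)%R.
        by rewrite ler_pM2r// invr_gt0.
      by rewrite mulrDl mulfK ?gt_eqF// expr2 mulfK ?gt_eqF// subr_ge0.
  rewrite ge0_integralD// ?ge0_integralZl//.
  - rewrite P1 mule1 EFinD leeD2l// EFinM [leRHS]muleC.
    by apply: lee_wpmul2l => //; rewrite lee_fin.
  - by rewrite lee_fin ltW.
  - by move=> x _; rewrite mule1 lee_fin ltW.
  - by move=> x _; rewrite mule_ge0 ?sq0// lee_fin.
  - exact: emeasurable_funM.
apply: le_trans amgm; rewrite -[leRHS]mul1e lee_wpmul2r//.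
  by apply: integral_ge0 => x _; rewrite lee_fin.
by rewrite lee_fin; lra.
Qed.

End dTV_bound.

(** * Second moment and asymptotics *)

Section chi_square.
Variables (R : realType) (sh : shift_model) (n m k : nat).
Variables (theta : 'I_m -> 'M[R]_k) (Bs : {set block n}).
Local Notation RR := (measurableTypeR R).
Implicit Types (K : {set block n}) (c : 'I_n * 'I_n).

Lemma labelings_gt0 K : #|K| = m -> (0 < #|labelings K m|)%N.
Proof.
move=> Km.
have cardS : #|{: {B | B \in K}}| = m by rewrite card_sig.
pose b : {ffun {B | B \in K} -> 'I_m} := [ffun B => cast_ord cardS (enum_rank B)].
apply/card_gt0P; exists b; rewrite inE; apply/andP; split.
  apply/injectiveP => B B'; rewrite !ffunE => /cast_ord_inj; exact: enum_rank_inj.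
apply/forallP => l; apply/existsP; exists (enum_val (cast_ord (esym cardS) l)).
by rewrite ffunE enum_valK cast_ordKV.
Qed.

(** Shift 0 gives the standard normal law in both models, so extending the templates by 0 turns the
    planted law into one formula valid at every cell. *)
Definition signal K (b : {ffun {B | B \in K} -> 'I_m}) c : R :=
  if [pick B : {B | B \in K} | c \in cells (val B)] is Some B then
    if coordinate_map k (val B) c is Some u then theta (b B) u.1 u.2 else 0
  else 0.

Lemma entry_law0 : entry_law sh 0 = (normal_prob 0 1 : probability RR R).
Proof. by case: sh; rewrite /entry_law ?addr0 ?sqrtr1. Qed.

Lemma planted_entry_lawE K (b : {ffun {B | B \in K} -> 'I_m}) c :
  planted_entry_law sh theta b c = entry_law sh (signal b c).
Proof.
rewrite /planted_entry_law /signal; case: pickP => [B _|_]; rewrite ?entry_law0//.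
by case: coordinate_map => [u|] //; rewrite entry_law0.
Qed.

Lemma signal_le (s : R) K (b : {ffun {B | B \in K} -> 'I_m}) c : 0 <= s ->
  (forall l u v, `|theta l u v| <= s) -> `|signal b c| <= s * (c \in support K)%:R.
Proof.
move=> s0 ths; rewrite /signal; case: pickP => [[B BK] /= cB|_].
  rewrite (_ : c \in support K) ?mulr1; last by apply/mem_support; exists B.
  by case: coordinate_map => [u|]; rewrite ?normr0.
by rewrite normr0 mulr_ge0.
Qed.

Variables (theta0 C s : R).
Hypothesis theta0_lt1 : 0 <= theta0 < 1.
Hypothesis theta_range : forall l u v, entry_range sh theta0 (theta l u v).
Hypothesis C0 : 0 <= C.
Hypothesis chi_entry : forall x y, entry_range sh theta0 x -> entry_range sh theta0 y ->
  (\int[(normal_prob 0 1 : probability RR R)]_t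
     (entry_ratio sh x t * entry_ratio sh y t)%:E <= (expR (C * (`|x| * `|y|)))%:E)%E.
Hypothesis s0 : 0 <= s.
Hypothesis theta_le : forall l u v, `|theta l u v| <= s.

Lemma signal_range K (b : {ffun {B | B \in K} -> 'I_m}) c :
  entry_range sh theta0 (signal b c).
Proof.
have r0 : entry_range sh theta0 0.
  by case: sh => //=; rewrite lexx; case/andP: theta0_lt1.
by rewrite /signal; case: pickP => [B _|//]; case: coordinate_map => [u|].
Qed.

Definition planted_ratio K (b : {ffun {B | B \in K} -> 'I_m}) :
    observation R n -> R :=
  fun X => \prod_c entry_ratio sh (signal b c) ((X : 'M[R]_n) c.1 c.2).

Definition placement_ratio K : observation R n -> R :=
  average (labelings K m) (@planted_ratio K).

Definition alternative_ratio : observation R n -> R :=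
  average (placements Bs m) placement_ratio.

Lemma density_planted K (b : {ffun {B | B \in K} -> 'I_m}) :
  density (independent_law (planted_entry_law sh theta b)) (null_law R n)
    (planted_ratio b).
Proof.
apply: (density_independent_law (mu := fun=> normal_prob 0 1 : probability RR R)
  (g := fun c => entry_ratio sh (signal b c))) => c; rewrite planted_entry_lawE.
exact: (density_entry_law (signal_range b c)).
Qed.

Lemma density_placement K :
  density (uniform_mixture (labelings K m) (fun b =>
      independent_law (planted_entry_law sh theta b)))
    (null_law R n) (placement_ratio K).
Proof. by apply: density_uniform_mixture => b _; exact: density_planted. Qed.

Lemma density_alternative :
  density (alternative_law sh Bs theta) (null_law R n) alternative_ratio.
Proof. by apply: density_uniform_mixture => K _; exact: density_placement. Qed.

(** Independence factors the integral over cells. The exponent is 0 off the common support and at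
    most C s^2 on it, uniformly in the labelings. *)
Lemma planted_ratio_product K K' (b : {ffun {B | B \in K} -> 'I_m})
    (b' : {ffun {B | B \in K'} -> 'I_m}) :
  (\int[null_law R n]_X (planted_ratio b X * planted_ratio b' X)%:E <=
   (expR (C * s ^+ 2 * #|finset.setI (support K) (support K')|%:R))%:E)%E.
Proof.
under eq_integral do rewrite /planted_ratio -big_split /=.
pose h c (t : RR) := entry_ratio sh (signal b c) t * entry_ratio sh (signal b' c) t.
apply: le_trans (integral_independent_prod (h := h)
  (b := fun c => expR (C * (`|signal b c| * `|signal b' c|))) _ _ _) _.
- by move=> c; apply: measurable_funM; exact: measurable_entry_ratio.
- by move=> c t; rewrite mulr_ge0// entry_ratio_ge0.
- by move=> c; apply: chi_entry; exact: signal_range.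
rewrite -expR_sum lee_fin ler_expR -mulr_sumr -mulrA ler_wpM2l//.
rewrite -sum1_card natr_sum mulr_sumr [leRHS]big_mkcond /=; apply: ler_sum => c _.
have := ler_pM (normr_ge0 _) (normr_ge0 _) (signal_le b c s0 theta_le)
  (signal_le b' c s0 theta_le).
move=> /le_trans; apply; rewrite finset.in_setI.
by case: (c \in support K); case: (c \in support K') => /=; rewrite ?mulr0 ?mul0r// !mulr1 expr2.
Qed.

Lemma measurable_planted K (b : {ffun {B | B \in K} -> 'I_m}) :
  measurable_fun setT (planted_ratio b) /\ (forall X, 0 <= planted_ratio b X).
Proof. by case: (density_planted b). Qed.

(** An inequality, because the average over an empty family is 0; callers need not know that
    labelings exist. *)
Lemma average_const_le (J : finType) (A : {set J}) (e : R) : 0 <= e ->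
  #|A|%:R^-1 * \sum_(j in A) e <= e.
Proof.
move=> e0; rewrite sumr_const -[X in _ * X]mulr_natl mulrA.
have [->|A0] := posnP #|A|; first by rewrite invr0 !mul0r.
by rewrite mulVf ?mul1r// pnatr_eq0 -lt0n.
Qed.

Lemma placement_ratio_product K K' :
  (\int[null_law R n]_X (placement_ratio K X * placement_ratio K' X)%:E <=
   (expR (C * s ^+ 2 * #|finset.setI (support K) (support K')|%:R))%:E)%E.
Proof.
have [mK' K'0 _] := density_placement K'.
set e := expR _; have e0 : 0 <= e by exact: expR_ge0.
apply: (@le_trans _ _ (#|labelings K m|%:R^-1 * \sum_(b in labelings K m) e)%:E); last first.
  by rewrite lee_fin; exact: average_const_le.
apply: integral_averageM_le => // [b _|b X _|b _].
- by case: (measurable_planted b).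
- by case: (measurable_planted b) => _; exact.
have [mb b0] := measurable_planted b.
under eq_integral do rewrite mulrC.
apply: (@le_trans _ _ (#|labelings K' m|%:R^-1 * \sum_(b in labelings K' m) e)%:E); last first.
  by rewrite lee_fin; exact: average_const_le.
apply: integral_averageM_le => // [b' _|b' X _|b' _].
- by case: (measurable_planted b').
- by case: (measurable_planted b') => _; exact.
by under eq_integral do rewrite mulrC; exact: planted_ratio_product.
Qed.

Lemma alternative_chi2 (eta : R) : (0 < #|placements Bs m|)%N ->
  (forall K, K \in placements Bs m -> \sum_(K' in placements Bs m)
     expR (C * s ^+ 2 * #|finset.setI (support K) (support K')|%:R) <=
     (1 + eta) * #|placements Bs m|%:R) ->
  (\int[null_law R n]_X (alternative_ratio X * alternative_ratio X)%:E <=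
   (1 + eta)%:E)%E.
Proof.
move=> P0 He.
have [mL L0 _] := density_alternative.
have P1 : 0 < #|placements Bs m|%:R :> R by rewrite ltr0n.
have avg1 (F : {set block n} -> R) (e : R) : \sum_(K in placements Bs m) F K <=
    e * #|placements Bs m|%:R ->
    #|placements Bs m|%:R^-1 * \sum_(K in placements Bs m) F K <= e.
  by move=> H; rewrite ler_pdivrMl// mulrC.
apply: (@le_trans _ _ (#|placements Bs m|%:R^-1 *
   \sum_(K in placements Bs m) (1 + eta))%:E); last first.
  by rewrite lee_fin avg1// sumr_const mulr_natr.
apply: integral_averageM_le => // [K _|K X _|K KP].
- by case: (density_placement K).
- by case: (density_placement K).
have [mK K0 _] := density_placement K.
under eq_integral do rewrite mulrC.
apply: (@le_trans _ _ (#|placements Bs m|%:R^-1 * \sum_(K' in placements Bs m)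
   expR (C * s ^+ 2 * #|finset.setI (support K) (support K')|%:R))%:E); last first.
  by rewrite lee_fin avg1// He.
apply: integral_averageM_le => // [K' _|K' X _|K' K'P].
- by case: (density_placement K').
- by case: (density_placement K').
by under eq_integral do rewrite mulrC; exact: placement_ratio_product.
Qed.

Lemma dTV_alternative (eta delta : R) : 0 < delta -> (0 < #|placements Bs m|)%N ->
  (forall K, K \in placements Bs m -> \sum_(K' in placements Bs m)
     expR (C * s ^+ 2 * #|finset.setI (support K) (support K')|%:R) <=
     (1 + eta) * #|placements Bs m|%:R) ->
  (dTV (null_law R n) (alternative_law sh Bs theta) <= (delta + eta / delta)%:E)%E.
Proof.
move=> d0 P0 He; apply: (dTV_chi2 density_alternative d0 _ (alternative_chi2 P0 He)).
apply: uniform_mixture_setT => // K /placementsP[_ Km _].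
apply: uniform_mixture_setT; first exact: labelings_gt0.
by move=> b _; exact: probability_setT.
Qed.

End chi_square.

(** * Entry bounds from energies, and limits in the extended reals *)

Section asymptotics.
Variable R : realType.

Lemma entry_le_norm k (M : 'M[R]_k) u v : `|M u v| <= `|M|.
Proof.
rewrite /Num.norm /= mx_normrE.
exact: (le_bigmax _ (fun ij : 'I_k * 'I_k => `|M ij.1 ij.2|) (u, v)).
Qed.

Lemma energy_ge0 k (M : 'M[R]_k) : 0 <= energy M.
Proof. by apply: sumr_ge0 => u _; exact: sqr_ge0. Qed.

Lemma max_energy_ge0 m k (theta : 'I_m -> 'M[R]_k) : 0 <= max_energy theta.
Proof. exact: bigmax_ge_id. Qed.

Lemma entry_sq_le m k (theta : 'I_m -> 'M[R]_k) (D : R) l u v : (0 < k)%N ->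
  \big[Num.max/0]_(l < m) (k%:R ^+ 2 * `|theta l| ^+ 2 / energy (theta l)) <= D ->
  `|theta l u v| ^+ 2 <= D * max_energy theta / k%:R ^+ 2.
Proof.
move=> k0 HD.
have D0 : 0 <= D by apply: le_trans HD; exact: bigmax_ge_id.
have k2 : 0 < k%:R ^+ 2 :> R by rewrite exprn_gt0// ltr0n.
have El : energy (theta l) <= max_energy theta.
  exact: (le_bigmax _ (fun l => energy (theta l)) l).
have uv : `|theta l u v| ^+ 2 <= energy (theta l).
  rewrite real_normK ?num_real// /energy (bigD1 (u, v))//= lerDl.
  by apply: sumr_ge0 => w _; exact: sqr_ge0.
(* For a zero template the ratio is 0 / 0 = 0 and carries no information, but its entries vanish. *)
have [E0|E0] := eqVneq (energy (theta l)) 0.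
  rewrite E0 in uv; apply: le_trans uv _.
  by rewrite divr_ge0 ?mulr_ge0 ?max_energy_ge0// ltW.
have E1 : 0 < energy (theta l) by rewrite lt_neqAle eq_sym E0 energy_ge0.
apply: (@le_trans _ _ (`|theta l| ^+ 2)).
  by rewrite lerXn2r ?nnegrE// entry_le_norm.
rewrite ler_pdivlMr// mulrC.
have := le_bigmax 0 (fun l => k%:R ^+ 2 * `|theta l| ^+ 2 / energy (theta l)) l.
move=> /le_trans/(_ HD); rewrite ler_pdivrMr// => /le_trans; apply.
by rewrite ler_wpM2l.
Qed.

Lemma dTV_ge0 d (T : measurableType d) (P Q : {finite_measure set T -> \bar R}) :
  (0 <= dTV P Q)%E.
Proof.
rewrite /dTV mule_ge0 ?lee_fin ?invr_ge0//.
Qed.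

Lemma cvg_ereal0 (f : nat -> \bar R) : (forall n, 0 <= f n)%E ->
  (forall e : R, 0 < e -> \forall n \near \oo, (f n <= e%:E)%E) ->
  f n @[n --> \oo] --> 0%E.
Proof.
move=> f0 fe; apply/fine_cvgP; split.
  near=> n; have : (f n <= 1%:E)%E by near: n; exact: fe.
  by move=> fn1; rewrite ge0_fin_numE// (le_lt_trans fn1)// ltry.
apply/cvgrPdist_le => e e0; near=> n.
have : (f n <= e%:E)%E by near: n; exact: fe.
rewrite sub0r normrN /=; case: (f n) (f0 n) => [r| |] //=.
by rewrite !lee_fin => r0 re; rewrite ger0_norm.
Unshelve. all: by end_near. Qed.

End asymptotics.


Theorem corollary6 (R : realType) (sh : shift_model) (m k : nat -> nat)
    (theta : forall n : nat, 'I_(m n) -> 'M[R]_(k n)) :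
  (forall n : nat, (0 < n)%N ->
    [/\ (0 < m n)%N, (0 < k n)%N & (m n * k n <= n)%N]) ->
  admissible_templates sh theta ->
  smooth_signal theta ->
  ((fun n : nat => max_energy (theta n)) =o_\oo
     (fun n : nat => Num.min ((k n)%:R : R)
        (n%:R ^+ 2 / ((m n)%:R ^+ 2 * (k n)%:R ^+ 2))) ->
   dTV (null_law R n) (alternative_law sh (blocks n (k n)) (theta n))
     @[n --> \oo] --> 0%E) /\
  ((fun n : nat => max_energy (theta n)) =o_\oo
     (fun n : nat => ln (1 + n%:R ^+ 2 / ((k n)%:R ^+ 2 * (m n)%:R ^+ 2) : R)) ->
   dTV (null_law R n) (alternative_law sh (circular_blocks n (k n)) (theta n))
     @[n --> \oo] --> 0%E).
Proof.
move=> dims adm [_ /eqO_exP[D0 [D0gt HD0]]].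
(* In the mean-shift model [entry_range] is trivial and theta0 = 0 is a placeholder. *)
have [theta0 t01 range] : exists2 theta0 : R, 0 <= theta0 < 1 &
    forall n, (0 < n)%N -> forall l u v, entry_range sh theta0 (theta n l u v).
  case: sh adm => /= [_|[t t01 ht]]; last by exists t.
  by exists 0 => //; rewrite lexx ltr01.
have [C C0 chi] := entry_chi_bound sh t01.
(* The summand 1 makes A positive even if C = 0, so that eps / A and d / A are legitimate small-o
   constants. *)
pose A := C * D0 + 1.
have A0 : 0 < A by rewrite ltr_wpDl// mulr_ge0// ltW.
pose E n := max_energy (theta n).
have E0 n : 0 <= E n := max_energy_ge0 _.
have entry_le n : (0 < n)%N ->
    \big[Num.max/0]_(l < m n) ((k n)%:R ^+ 2 * `|theta n l| ^+ 2 /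
      energy (theta n l)) <= D0 ->
    forall l u v, `|theta n l u v| <= Num.sqrt (D0 * E n / (k n)%:R ^+ 2).
  move=> n0 HD l u v; have [_ k0 _] := dims n n0.
  rewrite -[leLHS]ger0_norm// -sqrtr_sqr ler_wsqrtr//.
  exact: entry_sq_le.
have sq_s n : (0 < n)%N -> Num.sqrt (D0 * E n / (k n)%:R ^+ 2) ^+ 2 =
    D0 * E n / (k n)%:R ^+ 2.
  move=> n0; rewrite sqr_sqrtr// divr_ge0 ?mulr_ge0 ?exprn_ge0//; exact: ltW.
have nonspiky : \forall n \near \oo, \big[Num.max/0]_(l < m n)
    ((k n)%:R ^+ 2 * `|theta n l| ^+ 2 / energy (theta n l)) <= D0.
  near=> n; apply: le_trans (ler_norm _) _.
  rewrite -[leRHS]mulr1 -[X in _ <= _ * X](@normr1 R).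
  by near: n; exact: HD0.
split=> /eqoP small; apply: cvg_ereal0 => [n|e e0]; try exact: dTV_ge0.
(* With delta = e / 2 the bound delta + eta / delta equals e. *)
- pose eta := e ^+ 2 / 4.
  have eta0 : 0 < eta by rewrite divr_gt0 ?exprn_gt0.
  (* 64 eps <= eta / 2 and 64 eps <= 1/16 give (1 + eta) (1 - 64 eps) >= 1. *)
  pose eps := Num.min (1024^-1) (eta / 128).
  have eps0 : 0 < eps by rewrite lt_min invr_gt0 ltr0n divr_gt0.
  have epsA : 0 < eps / A by rewrite divr_gt0.
  have [eps1 eps2] : eps <= 1024^-1 /\ eps <= eta / 128.
    by split; rewrite ge_min lexx ?orbT.
  near=> n.
  have n0 : (0 < n)%N by near: n; exact: nbhs_infty_gt.
  have HD : \big[Num.max/0]_(l < m n) ((k n)%:R ^+ 2 * `|theta n l| ^+ 2 /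
      energy (theta n l)) <= D0 by near: n.
  have HE : `|E n| <= eps / A * `|Num.min ((k n)%:R : R)
        (n%:R ^+ 2 / ((m n)%:R ^+ 2 * (k n)%:R ^+ 2))|.
    by near: n; exact: small.
  have [m0 k0 mkn] := dims n n0.
  have k1 : 0 < (k n)%:R :> R by rewrite ltr0n.
  have m1 : 0 < (m n)%:R :> R by rewrite ltr0n.
  have n1 : 0 < n%:R :> R by rewrite ltr0n.
  rewrite ger0_norm// ger0_norm in HE; last first.
    by rewrite le_min ler0n divr_ge0 ?mulr_ge0 ?exprn_ge0.
  have [HE1 HE2] : A * E n <= eps * (k n)%:R /\
      A * E n <= eps * (n%:R ^+ 2 / ((m n)%:R ^+ 2 * (k n)%:R ^+ 2)).
    have H x : Num.min ((k n)%:R : R) (n%:R ^+ 2 / ((m n)%:R ^+ 2 * (k n)%:R ^+ 2)) <= x ->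
        A * E n <= eps * x.
      move=> /(ler_wpM2l (ltW eps0)); apply: le_trans.
      by rewrite -ler_pdivlMl// mulrA [_^-1 * _]mulrC.
    by split; apply: H; rewrite ge_min lexx ?orbT.
  have CDA : C * D0 * E n <= A * E n by rewrite ler_wpM2r// lerDl.
  have e20 : 0 < e / 2 by rewrite divr_gt0.
  have [K0 K0P] := diagonal_placement n0 k0 mkn.
  have P0 : (0 < #|placements (blocks n (k n)) (m n)|)%N.
    apply/card_gt0P; exists K0; apply: placements_sub K0P => B.
    by apply: circular_blocks_sub; apply: leq_trans mkn; rewrite leq_pmull.
  have := dTV_alternative t01 (range n n0) C0 chi (sqrtr_ge0 _) (entry_le n n0 HD)
    (eta := eta) e20 P0.
  rewrite (_ : e / 2 + eta / (e / 2) = e); last first.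
    by rewrite /eta; field; rewrite gt_eqF.
  apply => K KP; rewrite sq_s//.
  set lam := C * _.
  have lamE : lam = C * D0 * E n / (k n)%:R ^+ 2 by rewrite /lam !mulrA.
  have lam0 : 0 <= lam.
    by rewrite lamE divr_ge0 ?exprn_ge0// !mulr_ge0// ltW.
  have lamk : lam * (k n)%:R <= eps.
    rewrite lamE mulrAC ler_pdivrMr ?exprn_gt0// expr2 mulrA ler_pM2r//.
    exact: le_trans CDA HE1.
  have lammk : lam * ((m n)%:R ^+ 2 * (k n)%:R ^+ 4) <= eps * n%:R ^+ 2.
    have H := le_trans CDA HE2.
    rewrite mulrA ler_pdivlMr ?mulr_gt0 ?exprn_gt0// in H.
    rewrite (_ : lam * _ = C * D0 * E n * ((m n)%:R ^+ 2 * (k n)%:R ^+ 2))//.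
    by rewrite lamE; field; rewrite gt_eqF.
  have := sum_expR_blocks n0 k0 mkn lam0 eps1 lamk lammk KP.
  set S := \sum_(K' in _) _; move=> HS.
  have S0 : 0 <= S by apply: sumr_ge0 => K' _; exact: expR_ge0.
  have eta1 : 0 <= 1 + eta by rewrite addr_ge0// ltW.
  apply: le_trans (ler_wpM2l eta1 HS).
  rewrite mulrA ler_peMl//.
  by have := ler_wpM2r (ltW eta0) eps1; lra.
- pose eta := e ^+ 2 / 4.
  have eta0 : 0 < eta by rewrite divr_gt0 ?exprn_gt0.
  have ln0 : 0 < ln (1 + eta) by rewrite ln_gt0// ltrDl.
  (* Chosen so that exp(512 d) <= 1 + eta; d <= 1 is needed for the chord bound. *)
  pose d := Num.min 1 (ln (1 + eta) / 512).
  have d0 : 0 < d by rewrite lt_min ltr01 divr_gt0 ?ltr0n.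
  have [d1 d2] : d <= 1 /\ d <= ln (1 + eta) / 512.
    by split; rewrite ge_min lexx ?orbT.
  have d01 : 0 <= d <= 1 by rewrite ltW.
  have dA : 0 < d / A by rewrite divr_gt0.
  near=> n.
  have n0 : (0 < n)%N by near: n; exact: nbhs_infty_gt.
  have HD : \big[Num.max/0]_(l < m n) ((k n)%:R ^+ 2 * `|theta n l| ^+ 2 /
      energy (theta n l)) <= D0 by near: n.
  have HE : `|E n| <= d / A *
      `|ln (1 + n%:R ^+ 2 / ((k n)%:R ^+ 2 * (m n)%:R ^+ 2) : R)|.
    by near: n; exact: small.
  have [m0 k0 mkn] := dims n n0.
  have k1 : 0 < (k n)%:R :> R by rewrite ltr0n.
  have m1 : 0 < (m n)%:R :> R by rewrite ltr0n.
  rewrite ger0_norm// ger0_norm in HE; last first.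
    by rewrite ln_ge0// lerDl divr_ge0 ?mulr_ge0 ?exprn_ge0.
  have CDA : C * D0 * E n <= A * E n by rewrite ler_wpM2r// lerDl.
  pose t := C * D0 * E n.
  have t0 : 0 <= t by rewrite !mulr_ge0// ltW.
  have td : t <= d * ln (1 + n%:R ^+ 2 / ((k n)%:R ^+ 2 * (m n)%:R ^+ 2)).
    by apply: le_trans CDA _; rewrite -ler_pdivlMl// mulrA [_^-1 * _]mulrC.
  have e20 : 0 < e / 2 by rewrite divr_gt0.
  have [K0 K0P] := diagonal_placement n0 k0 mkn.
  have P0 : (0 < #|placements (circular_blocks n (k n)) (m n)|)%N.
    by apply/card_gt0P; exists K0.
  have := dTV_alternative t01 (range n n0) C0 chi (sqrtr_ge0 _) (entry_le n n0 HD)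
    (eta := eta) e20 P0.
  rewrite (_ : e / 2 + eta / (e / 2) = e); last first.
    by rewrite /eta; field; rewrite gt_eqF.
  apply => K KP; rewrite sq_s// !mulrA -/t.
  apply: le_trans (sum_expR_circular n0 m0 k0 mkn t0 d01 td KP) _.
  rewrite ler_wpM2r// -[leRHS]lnK ?posrE; last by rewrite addr_gt0.
  by rewrite ler_expR mulrC -ler_pdivlMr ?ltr0n.
Unshelve. all: by end_near. Qed.
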